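(* If $X$ is a compact geodesic space, then $\bar{\pi}_1^{top}(X)$ is a $T_1$ quasitopological group, and $X$ has a universal cover if and only if $\bar{\pi}_1^{top}(X)$ is discrete.
   Context: A geodesic space is a metric space in which any two points are joined by a curve whose length equals the distance between them. A cover of $X$ is a connected covering space in the traditional sense. A universal cover of $X$ is a cover $f:Y\to X$ such that for any cover $g:Z\to X$ there is a cover $h:Y\to Z$ with $g\circ h=f$ (not necessarily simply connected). A quasitopological group is a group with a topology for which inversion is continuous and multiplication is continuous in each variable separately. Let $X$ be a geodesic space with base point $*$ (immaterial up to isomorphism). For $\varepsilon>0$, an $\varepsilon$-chain is a finite sequence $\{x_0,\dots,x_n\}$ in $X$ with $d(x_{i-1},x_i)<\varepsilon$ for all $i$. A basic move adds or removes one point, keeping the endpoints fixed and keeping the result an $\varepsilon$-chain; two $\varepsilon$-chains are $\varepsilon$-homotopic if connected by finitely many basic moves. $\pi_\varepsilon(X)$ is the group, under concatenation, of $\varepsilon$-homotopy classes of $\varepsilon$-chains that start and end at $*$. A strong $\varepsilon$-chain along a path $\gamma:[a,b]\to X$ is an $\varepsilon$-chain $\{\gamma(t_0),\dots,\gamma(t_n)\}$ for a partition $a=t_0<\dots<t_n=b$ with $\gamma([t_{i-1},t_i])\subset B_\varepsilon(\gamma(t_{i-1}))\cap B_\varepsilon(\gamma(t_i))$ for each $i$. The well-defined surjective homomorphism $h_\varepsilon:\pi_1(X)\to\pi_\varepsilon(X)$ sends $[\gamma]$ to the class of any strong $\varepsilon$-chain along $\gamma$. Put $K_\varepsilon=\ker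 h_\varepsilon$, $\pi_{cl}(X)=\bigcap_{\varepsilon>0}K_\varepsilon$ and $\bar{\pi}_1(X)=\pi_1(X)/\pi_{cl}(X)$. $\pi_1^{top}(X)$ is $\pi_1(X,* )$ with the quotient topology, under the homotopy relation, from the space of continuous loops $f:[0,1]\to X$, $f(0)=f(1)=*$, with the uniform topology (equivalently compact-open topology). $\bar{\pi}_1^{top}(X)$ is $\bar{\pi}_1(X)$ with the quotient topology inherited from $\pi_1^{top}(X)$. *)

(* Defs.v *)
From HB Require Import structures.
From Stdlib Require Import Relation_Operators.
From mathcomp Require Import all_boot all_order all_algebra generic_quotient.
From mathcomp Require Import all_classical all_reals all_analysis.
From mathcomp Require Import wedge_sigT continuous_path lra.

Set Implicit Arguments.
Unset Strict Implicit.
Unset Printing Implicit Defensive.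

Import Order.TTheory GRing.Theory Num.Theory.
Import numFieldTopology.Exports numFieldNormedType.Exports.
Local Open Scope classical_set_scope.
Local Open Scope ring_scope.
Local Open Scope quotient_scope.

Definition unitI (R : realType) : Type := set_type (`[0, 1]%classic : set R).

Section unit_interval.
Context {R : realType}.

HB.instance Definition _ := Choice.copy (unitI R) (set_type `[(0 : R), 1]).
HB.instance Definition _ := Topological.copy (unitI R) (set_type `[(0 : R), 1]).

Definition unit_val (t : unitI R) : R := set_val t.

Lemma clamp_subproof (r : R) : Num.max 0 (Num.min r 1) \in `[(0 : R), 1]%classic.
Proof.
rewrite inE/= in_itv/= le_max lexx/= ge_max ler01/=.
by rewrite ge_min lexx orbT.
Qed.

Definition clamp (r : R) : unitI R :=
  exist (fun x => x \in `[(0 : R), 1]%classic) _ (clamp_subproof r).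

Lemma unit_valP (t : unitI R) : 0 <= unit_val t <= 1.
Proof. by have := set_valP t; rewrite /= in_itv. Qed.

Lemma unit_val_inj : injective unit_val.
Proof. by move=> s t /val_inj. Qed.

Lemma clampE (r : R) : 0 <= r <= 1 -> unit_val (clamp r) = r.
Proof.
by move=> /andP[r0 r1]; rewrite /unit_val set_valE/= min_l// max_r.
Qed.

Lemma clampK : cancel unit_val clamp.
Proof. by move=> t; apply/unit_val_inj/clampE/unit_valP. Qed.

Lemma unit_val_continuous : continuous unit_val.
Proof. exact: (@initial_continuous _ _ set_val). Qed.

Lemma clamp_continuous : continuous clamp.
Proof.
move=> r; apply/(@continuous_comp_initial _ _ _ set_val clamp) => {}r.
have -> : set_val \o clamp = (fun r => Num.max 0 (Num.min r 1)).
  by apply/funext.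
apply: (@continuous_max R R (cst 0) (fun r => Num.min r 1)).
  exact: cvg_cst.
apply: (@continuous_min R R id (cst 1)); first exact: cvg_id.
exact: cvg_cst.
Qed.

Lemma unit_zero_one_neq : clamp 0 != clamp 1.
Proof.
apply/negP => /eqP/(congr1 unit_val).
by rewrite !clampE ?lexx ?ler01// => /esym/eqP; rewrite oner_eq0.
Qed.

HB.instance Definition _ := isBiPointed.Build (unitI R) unit_zero_one_neq.

Lemma unit_val0 : unit_val zero = 0.
Proof. by rewrite /zero/= clampE// lexx ler01. Qed.

Lemma unit_val1 : unit_val one = 1.
Proof. by rewrite /one/= clampE// lexx ler01. Qed.

End unit_interval.

Section gluing.
Context {R : realType}.

Lemma glue_continuous {T U : topologicalType} (phi : T -> R) (c : R)
    (F G : T -> U) :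
  continuous phi -> continuous F -> continuous G ->
  (forall x, phi x = c -> F x = G x) ->
  continuous (fun x => if phi x <= c then F x else G x).
Proof.
move=> cphi cF cG FG; set K := (X in continuous X).
pose A := phi @^-1` [set r | r <= c]; pose B := phi @^-1` [set r | c <= r].
have AB : A `|` B = [set: T].
  apply/seteqP; split=> // x _; have [xc|/ltW xc] := leP (phi x) c.
    by left.
  by right.
apply/continuous_subspace_setT; rewrite -AB; apply: withinU_continuous.
- by apply: closed_comp => [x _|]; [exact: cphi|exact: closed_le].
- by apply: closed_comp => [x _|]; [exact: cphi|exact: closed_ge].
- apply: (@subspace_eq_continuous _ _ _ F); last exact: continuous_subspaceT.
  by move=> x /set_mem Ax; rewrite /from_subspace /K ifT.
- apply: (@subspace_eq_continuous _ _ _ G); last exact: continuous_subspaceT.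
  move=> x /set_mem; rewrite /from_subspace /K /B/= => cx.
  by case: leP => // xc; rewrite FG//; apply/eqP; rewrite eq_le xc cx.
Qed.

Lemma clamp_comp_continuous {T : topologicalType} (phi : T -> R) :
  continuous phi -> continuous (clamp \o phi).
Proof.
by move=> cphi x; apply: continuous_comp; [exact: cphi|exact: clamp_continuous].
Qed.

Lemma affine_continuous {T : topologicalType} (a b : R) (phi : T -> R) :
  continuous phi -> continuous (fun x => a * phi x + b).
Proof.
move=> cphi x; apply: cvgD; last exact: cvg_cst.
by apply: cvgM; [exact: cvg_cst|exact: cphi].
Qed.

Lemma clamp_double_continuous {T : topologicalType} (phi : T -> R) :
  continuous phi -> continuous (fun x => clamp (2 * phi x)).
Proof.
move=> cphi; apply: (clamp_comp_continuous (phi := fun x => 2 * phi x)) => x.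
by apply: cvgM; [exact: cvg_cst|exact: cphi].
Qed.

Lemma clamp_double1_continuous {T : topologicalType} (phi : T -> R) :
  continuous phi -> continuous (fun x => clamp (2 * phi x - 1)).
Proof.
move=> cphi; apply: (clamp_comp_continuous (phi := fun x => 2 * phi x - 1)) => x.
apply: cvgB; last exact: cvg_cst.
by apply: cvgM; [exact: cvg_cst|exact: cphi].
Qed.

Lemma clamp_flip_continuous {T : topologicalType} (phi : T -> R) :
  continuous phi -> continuous (fun x => clamp (1 - phi x)).
Proof.
move=> cphi; apply: (clamp_comp_continuous (phi := fun x => 1 - phi x)) => x.
by apply: cvgB; [exact: cvg_cst|exact: cphi].
Qed.

End gluing.

Section path_operations.
Context {R : realType} {X : topologicalType}.
Implicit Types x y z : X.

Definition concat_fun (f g : unitI R -> X) (t : unitI R) : X :=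
  if unit_val t <= 2^-1 then f (clamp (2 * unit_val t))
  else g (clamp (2 * unit_val t - 1)).

Definition reverse_fun (f : unitI R -> X) (t : unitI R) : X :=
  f (clamp (1 - unit_val t)).

Lemma concat_fun_continuous (f g : unitI R -> X) :
  continuous f -> continuous g -> f one = g zero -> continuous (concat_fun f g).
Proof.
move=> cf cg fg; apply: glue_continuous.
- exact: unit_val_continuous.
- move=> t; apply: (@continuous_comp _ _ _ (fun t => clamp (2 * unit_val t)) f).
    exact/clamp_double_continuous/unit_val_continuous.
  exact: cf.
- move=> t; apply: (@continuous_comp _ _ _ (fun t => clamp (2 * unit_val t - 1)) g).
    exact/clamp_double1_continuous/unit_val_continuous.
  exact: cg.
- move=> t ->; rewrite divff// subrr; exact: fg.
Qed.

Lemma reverse_fun_continuous (f : unitI R -> X) :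
  continuous f -> continuous (reverse_fun f).
Proof.
move=> cf t; apply: (@continuous_comp _ _ _ (fun t => clamp (1 - unit_val t)) f).
  exact/clamp_flip_continuous/unit_val_continuous.
exact: cf.
Qed.

Lemma concat_fun0 (f g : unitI R -> X) : concat_fun f g zero = f zero.
Proof. by rewrite /concat_fun unit_val0 invr_ge0 ler0n mulr0. Qed.

Lemma concat_fun1 (f g : unitI R -> X) : concat_fun f g one = g one.
Proof.
rewrite /concat_fun unit_val1 ifF; last by apply/negbTE; rewrite -ltNge; lra.
by congr g; apply: unit_val_inj; rewrite unit_val1 clampE; lra.
Qed.

Lemma reverse_fun0 (f : unitI R -> X) : reverse_fun f zero = f one.
Proof. by rewrite /reverse_fun unit_val0 subr0. Qed.

Lemma reverse_fun1 (f : unitI R -> X) : reverse_fun f one = f zero.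
Proof. by rewrite /reverse_fun unit_val1 subrr. Qed.

Lemma path_concat_subproof x y z (f : {path unitI R from x to y in X})
  (g : {path unitI R from y to z in X}) : f one = g zero.
Proof. by rewrite path_one path_zero. Qed.

Lemma path_concat0 x y z (f : {path unitI R from x to y in X})
  (g : {path unitI R from y to z in X}) : concat_fun f g zero = x.
Proof. by rewrite concat_fun0 path_zero. Qed.

Lemma path_concat1 x y z (f : {path unitI R from x to y in X})
  (g : {path unitI R from y to z in X}) : concat_fun f g one = z.
Proof. by rewrite concat_fun1 path_one. Qed.

Lemma path_reverse0 x y (f : {path unitI R from x to y in X}) :
  reverse_fun f zero = y.
Proof. by rewrite reverse_fun0 path_one. Qed.

Lemma path_reverse1 x y (f : {path unitI R from x to y in X}) :
  reverse_fun f one = x.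
Proof. by rewrite reverse_fun1 path_zero. Qed.

Definition path_concat x y z (f : {path unitI R from x to y in X})
    (g : {path unitI R from y to z in X}) : {path unitI R from x to z in X} :=
  mk_path (concat_fun_continuous (@cts_fun _ _ f) (@cts_fun _ _ g)
    (path_concat_subproof f g)) (path_concat0 f g) (path_concat1 f g).

Definition path_reverse x y (f : {path unitI R from x to y in X}) :
    {path unitI R from y to x in X} :=
  mk_path (reverse_fun_continuous (@cts_fun _ _ f)) (path_reverse0 f)
    (path_reverse1 f).

End path_operations.

Section path_homotopy.
Context {R : realType} {X : topologicalType}.
Implicit Types x y z : X.

Definition path_homotopic x y (f g : {path unitI R from x to y in X}) : Prop :=
  exists H : unitI R * unitI R -> X,
    [/\ continuous H,
        forall t, H (t, zero) = f t, forall t, H (t, one) = g t,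
        forall s, H (zero, s) = x & forall s, H (one, s) = y].

Let fst_cont : continuous (fun u : unitI R * unitI R => unit_val u.1).
Proof.
move=> u; apply: (@continuous_comp _ _ _ fst unit_val); first exact: cvg_fst.
exact: unit_val_continuous.
Qed.

Let snd_cont : continuous (fun u : unitI R * unitI R => unit_val u.2).
Proof.
move=> u; apply: (@continuous_comp _ _ _ snd unit_val); first exact: cvg_snd.
exact: unit_val_continuous.
Qed.

Let comp2 (H : unitI R * unitI R -> X) (a b : unitI R * unitI R -> unitI R) :
  continuous H -> continuous a -> continuous b ->
  continuous (fun u => H (a u, b u)).
Proof.
move=> cH ca cb u; apply: (@continuous_comp _ _ _ (fun u => (a u, b u)) H).
  by apply: (@cvg_pair _ _ _ _ (nbhs (a u)) (nbhs (b u))); [exact: ca|exact: cb].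
exact: cH.
Qed.

Lemma path_homotopic_refl x y (f : {path unitI R from x to y in X}) :
  path_homotopic f f.
Proof.
exists (f \o fst); split=> //=.
- move=> u; apply: continuous_comp; [exact: cvg_fst|exact: cts_fun].
- by move=> _; rewrite path_zero.
- by move=> _; rewrite path_one.
Qed.

Lemma path_homotopic_sym x y (f g : {path unitI R from x to y in X}) :
  path_homotopic f g -> path_homotopic g f.
Proof.
move=> [H [cH H0 H1 Hx Hy]].
exists (fun u => H (u.1, clamp (1 - unit_val u.2))); split=> /=.
- apply: comp2 => //; first by move=> u; exact: cvg_fst.
  exact: clamp_flip_continuous.
- by move=> t; rewrite unit_val0 subr0 -H1.
- by move=> t; rewrite unit_val1 subrr -H0.
- by move=> s; rewrite Hx.
- by move=> s; rewrite Hy.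
Qed.

Lemma path_homotopic_trans x y (f g h : {path unitI R from x to y in X}) :
  path_homotopic f g -> path_homotopic g h -> path_homotopic f h.
Proof.
move=> [H [cH H0 H1 Hx Hy]] [K [cK K0 K1 Kx Ky]].
exists (fun u => if unit_val u.2 <= 2^-1 then H (u.1, clamp (2 * unit_val u.2))
                 else K (u.1, clamp (2 * unit_val u.2 - 1))); split=> /=.
- apply: glue_continuous => //.
  + apply: comp2 => //; first by move=> u; exact: cvg_fst.
    exact: clamp_double_continuous.
  + apply: comp2 => //; first by move=> u; exact: cvg_fst.
    exact: clamp_double1_continuous.
  + by move=> u ->; rewrite divff// subrr H1 K0.
- by move=> t; rewrite unit_val0 invr_ge0 ler0n mulr0 H0.
- move=> t; rewrite unit_val1 ifF; last by apply/negbTE; rewrite -ltNge; lra.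
  by rewrite -K1; congr (K (_, _)); apply: unit_val_inj; rewrite unit_val1 clampE; lra.
- by move=> s; case: ifP => _; rewrite ?Hx ?Kx.
- by move=> s; case: ifP => _; rewrite ?Hy ?Ky.
Qed.

Lemma path_concat_homotopic x y z
    (f f' : {path unitI R from x to y in X})
    (g g' : {path unitI R from y to z in X}) :
  path_homotopic f f' -> path_homotopic g g' ->
  path_homotopic (path_concat f g) (path_concat f' g').
Proof.
move=> [H [cH H0 H1 Hx Hy]] [K [cK K0 K1 Kx Ky]].
exists (fun u => if unit_val u.1 <= 2^-1 then H (clamp (2 * unit_val u.1), u.2)
                 else K (clamp (2 * unit_val u.1 - 1), u.2)); split=> /=.
- apply: glue_continuous => //.
  + apply: comp2 => //; last by move=> u; exact: cvg_snd.
    exact: clamp_double_continuous.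
  + apply: comp2 => //; last by move=> u; exact: cvg_snd.
    exact: clamp_double1_continuous.
  + by move=> u ->; rewrite divff// subrr Hy Kx.
- by move=> t; rewrite H0 K0.
- by move=> t; rewrite H1 K1.
- by move=> s; rewrite unit_val0 invr_ge0 ler0n mulr0 Hx.
- move=> s; rewrite unit_val1 ifF; last by apply/negbTE; rewrite -ltNge; lra.
  by rewrite -[RHS](Ky s); congr (K (_, _)); apply: unit_val_inj; rewrite unit_val1 clampE; lra.
Qed.

Lemma path_reverse_homotopic x y (f f' : {path unitI R from x to y in X}) :
  path_homotopic f f' -> path_homotopic (path_reverse f) (path_reverse f').
Proof.
move=> [H [cH H0 H1 Hx Hy]].
exists (fun u => H (clamp (1 - unit_val u.1), u.2)); split=> /=.
- apply: comp2 => //; last by move=> u; exact: cvg_snd.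
  exact: clamp_flip_continuous.
- by move=> t; rewrite H0.
- by move=> t; rewrite H1.
- by move=> s; rewrite unit_val0 subr0 Hy.
- by move=> s; rewrite unit_val1 subrr Hx.
Qed.

End path_homotopy.

Section path_group_laws.
Context {R : realType} {X : topologicalType}.
Implicit Types x y z w : X.

Lemma path_homotopic_reparam x y (f g : {path unitI R from x to y in X})
    (h : unitI R -> X) (phi psi : unitI R -> R) :
  continuous h -> continuous phi -> continuous psi ->
  phi zero = psi zero -> phi one = psi one ->
  (forall t, f t = h (clamp (phi t))) -> (forall t, g t = h (clamp (psi t))) ->
  path_homotopic f g.
Proof.
move=> ch cphi cpsi e0 e1 fE gE.
pose m (u : unitI R * unitI R) :=
  (1 - unit_val u.2) * phi u.1 + unit_val u.2 * psi u.1.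
have snd_cont : continuous (fun u : unitI R * unitI R => unit_val u.2).
  move=> u; apply: (@continuous_comp _ _ _ snd unit_val); first exact: cvg_snd.
  exact: unit_val_continuous.
have fst_cont (k : unitI R -> R) :
    continuous k -> continuous (fun u : unitI R * unitI R => k u.1).
  by move=> ck u; apply: (@continuous_comp _ _ _ fst k); [exact: cvg_fst|exact: ck].
have cm : continuous m.
  move=> u; apply: cvgD; apply: cvgM.
  - by apply: cvgB; [exact: cvg_cst|exact: snd_cont].
  - exact: fst_cont.
  - exact: snd_cont.
  - exact: fst_cont.
exists (fun u => h (clamp (m u))); split.
- move=> u; apply: (@continuous_comp _ _ _ (clamp \o m) h); last exact: ch.
  exact: clamp_comp_continuous.
- by move=> t; rewrite /m/= unit_val0 subr0 mul1r mul0r addr0 fE.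
- by move=> t; rewrite /m/= unit_val1 subrr mul1r mul0r add0r gE.
- move=> s; rewrite /m/= -e0 -mulrDl subrK mul1r -fE; exact: path_zero.
- move=> s; rewrite /m/= -e1 -mulrDl subrK mul1r -fE; exact: path_one.
Qed.

Lemma clamp_eq (t : unitI R) (r : R) : unit_val t = r -> clamp r = t.
Proof. by move=> <-; rewrite clampK. Qed.

Let aff (a b : R) : continuous (fun t : unitI R => a * unit_val t + b).
Proof.
exact/affine_continuous/unit_val_continuous.
Qed.

Let cmin (f g : unitI R -> R) : continuous f -> continuous g ->
  continuous (fun t => Num.min (f t) (g t)).
Proof.
by move=> cf cg t; apply: (@continuous_min R (unitI R) f g); [exact: cf|exact: cg].
Qed.

Let cmax (f g : unitI R -> R) : continuous f -> continuous g ->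
  continuous (fun t => Num.max (f t) (g t)).
Proof.
by move=> cf cg t; apply: (@continuous_max R (unitI R) f g); [exact: cf|exact: cg].
Qed.

Lemma path_concatA x y z w (f : {path unitI R from x to y in X})
    (g : {path unitI R from y to z in X}) (k : {path unitI R from z to w in X}) :
  path_homotopic (path_concat f (path_concat g k))
                 (path_concat (path_concat f g) k).
Proof.
apply: path_homotopic_sym.
pose phi (t : unitI R) := Num.min (2 * unit_val t + 0)
  (Num.min (1 * unit_val t + 4^-1) (2^-1 * unit_val t + 2^-1)).
apply: (@path_homotopic_reparam _ _ _ _ (path_concat f (path_concat g k))
  phi unit_val).
- exact: cts_fun.
- by apply: cmin; [exact: aff|apply: cmin; exact: aff].
- exact: unit_val_continuous.
- by rewrite /phi unit_val0 !mulr0 !add0r min_l// le_min; lra.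
- by rewrite /phi unit_val1 [X in Num.min _ X]min_r ?min_r; lra.
- move=> t; rewrite /path_concat/= /mk_path/= /concat_fun.
  have /andP[t0 t1] := unit_valP t.
  have cE (r : R) : 0 <= r <= 1 -> unit_val (clamp r) = r by exact: clampE.
  have [le|lt] := leP (unit_val t) 2^-1.
    have [le4|lt4] := leP (unit_val t) 4^-1.
      have -> : phi t = 2 * unit_val t.
        by rewrite /phi min_l ?addr0// le_min; lra.
      rewrite (cE (2 * unit_val t)); last by lra.
      by rewrite !ifT//; lra.
    have -> : phi t = unit_val t + 4^-1.
      by rewrite /phi [X in Num.min _ X]min_l ?min_r; lra.
    rewrite (cE (2 * unit_val t)); last by lra.
    rewrite (cE (unit_val t + 4^-1)); last by lra.
    rewrite ifF; last by apply/negbTE; rewrite -ltNge; lra.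
    rewrite ifF; last by apply/negbTE; rewrite -ltNge; lra.
    rewrite (cE (2 * (unit_val t + 4^-1) - 1)); last by lra.
    rewrite ifT; last by lra.
    by congr (g (clamp _)); lra.
  have -> : phi t = 2^-1 * unit_val t + 2^-1.
    by rewrite /phi [X in Num.min _ X]min_r ?min_r; lra.
  rewrite (cE (2^-1 * unit_val t + 2^-1)); last by lra.
  rewrite ifF; last by apply/negbTE; rewrite -ltNge; lra.
  rewrite (cE (2 * (2^-1 * unit_val t + 2^-1) - 1)); last by lra.
  rewrite ifF; last by apply/negbTE; rewrite -ltNge; lra.
  by congr (k (clamp _)); lra.
- by move=> t; rewrite clampK.
Qed.

Lemma path_concat1p x y (f : {path unitI R from x to y in X}) :
  path_homotopic (path_concat (cst x : {path unitI R from x to x in X}) f) f.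
Proof.
pose phi (t : unitI R) := Num.max (0 * unit_val t + 0) (2 * unit_val t + -1).
apply: (@path_homotopic_reparam _ _ _ _ f phi unit_val).
- exact: cts_fun.
- by apply: cmax; exact: aff.
- exact: unit_val_continuous.
- by rewrite /phi unit_val0 max_l; lra.
- by rewrite /phi unit_val1 max_r; lra.
- move=> t; rewrite /path_concat/= /mk_path/= /concat_fun.
  have /andP[t0 t1] := unit_valP t.
  have [le|lt] := leP (unit_val t) 2^-1.
    rewrite /phi max_l; last by lra.
    by rewrite mul0r addr0; exact/esym/path_zero.
  by rewrite /phi max_r; last by lra.
- by move=> t; rewrite clampK.
Qed.

Lemma path_concatp1 x y (f : {path unitI R from x to y in X}) :
  path_homotopic (path_concat f (cst y : {path unitI R from y to y in X})) f.
Proof.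
pose phi (t : unitI R) := Num.min (0 * unit_val t + 1) (2 * unit_val t + 0).
apply: (@path_homotopic_reparam _ _ _ _ f phi unit_val).
- exact: cts_fun.
- by apply: cmin; exact: aff.
- exact: unit_val_continuous.
- by rewrite /phi unit_val0 min_r; lra.
- by rewrite /phi unit_val1 min_l; lra.
- move=> t; rewrite /path_concat/= /mk_path/= /concat_fun.
  have /andP[t0 t1] := unit_valP t.
  have [le|lt] := leP (unit_val t) 2^-1.
    by rewrite /phi min_r; [rewrite addr0|lra].
  rewrite /phi min_l; last by lra.
  by rewrite mul0r add0r; exact/esym/path_one.
- by move=> t; rewrite clampK.
Qed.

Lemma path_concatNp x y (f : {path unitI R from x to y in X}) :
  path_homotopic (path_concat (path_reverse f) f)
    (cst y : {path unitI R from y to y in X}).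
Proof.
pose phi (t : unitI R) := Num.max (-2 * unit_val t + 1) (2 * unit_val t + -1).
apply: (@path_homotopic_reparam _ _ _ _ f phi (fun t => 0 * unit_val t + 1)).
- exact: cts_fun.
- by apply: cmax; exact: aff.
- exact: aff.
- by rewrite /phi unit_val0 max_l; lra.
- by rewrite /phi unit_val1 max_r; lra.
- move=> t; rewrite /path_concat/= /mk_path/= /concat_fun.
  have /andP[t0 t1] := unit_valP t.
  have [le|lt] := leP (unit_val t) 2^-1.
    rewrite /phi max_l; last by lra.
    rewrite /path_reverse/= /mk_path /reverse_fun clampE; last by lra.
    by congr (f (clamp _)); lra.
  by rewrite /phi max_r; last by lra.
- by move=> t; rewrite mul0r add0r; exact/esym/path_one.
Qed.

Lemma path_concatpN x y (f : {path unitI R from x to y in X}) :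
  path_homotopic (path_concat f (path_reverse f))
    (cst x : {path unitI R from x to x in X}).
Proof.
pose phi (t : unitI R) := Num.min (2 * unit_val t + 0) (-2 * unit_val t + 2).
apply: (@path_homotopic_reparam _ _ _ _ f phi (fun t => 0 * unit_val t + 0)).
- exact: cts_fun.
- by apply: cmin; exact: aff.
- exact: aff.
- by rewrite /phi unit_val0 min_l; lra.
- by rewrite /phi unit_val1 min_r; lra.
- move=> t; rewrite /path_concat/= /mk_path/= /concat_fun.
  have /andP[t0 t1] := unit_valP t.
  have [le|lt] := leP (unit_val t) 2^-1.
    by rewrite /phi min_l; [rewrite addr0|lra].
  rewrite /phi min_r; last by lra.
  rewrite /path_reverse/= /mk_path /reverse_fun clampE; last by lra.
  by congr (f (clamp _)); lra.
- by move=> t; rewrite mul0r addr0; exact/esym/path_zero.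
Qed.

End path_group_laws.

Section fundamental_group.
Context {R : realType} {X : metricType R}.

Definition loop (p : X) : Type := {path unitI R from p to p in X}.

HB.instance Definition _ p := Choice.copy (loop p) {path unitI R from p to p in X}.

Definition loop_fun (p : X) (f : loop p) : {uniform unitI R -> X} := f.

(* The uniform topology, instead of the compact-open topology that is canonical
   on {path _ from _ to _}. *)
HB.instance Definition _ p :=
  Topological.copy (loop p) (initial_topology (@loop_fun p)).

Definition loop_homotopic (p : X) : rel (loop p) :=
  fun f g => `[< path_homotopic f g >].

Lemma loop_homotopic_refl p : reflexive (@loop_homotopic p).
Proof. by move=> f; apply/asboolP/path_homotopic_refl. Qed.

Lemma loop_homotopic_sym p : symmetric (@loop_homotopic p).
Proof.
by move=> f g; apply/idP/idP => /asboolP fg; apply/asboolP/path_homotopic_sym.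
Qed.

Lemma loop_homotopic_trans p : transitive (@loop_homotopic p).
Proof.
move=> g f h /asboolP fg /asboolP gh; apply/asboolP.
exact: path_homotopic_trans gh.
Qed.

Canonical loop_homotopic_equiv p := EquivRel (@loop_homotopic p)
  (@loop_homotopic_refl p) (@loop_homotopic_sym p) (@loop_homotopic_trans p).

Definition pi1 (p : X) : Type :=
  quotient_topology {eq_quot loop_homotopic_equiv p}.

HB.instance Definition _ p := Quotient.on (pi1 p).
HB.instance Definition _ p := Topological.on (pi1 p).

Definition homotopy_class (p : X) (f : loop p) : pi1 p := \pi_(pi1 p) f.

Lemma homotopy_classP (p : X) (f g : loop p) :
  homotopy_class f = homotopy_class g <-> path_homotopic f g.
Proof.
split=> [/eqmodP/asboolP//|fg]; exact/eqmodP/asboolP.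
Qed.

Definition pi1_one (p : X) : pi1 p :=
  homotopy_class (cst p : {path unitI R from p to p in X}).

Definition pi1_mul (p : X) (a b : pi1 p) : pi1 p :=
  homotopy_class (path_concat (repr a) (repr b)).

Definition pi1_inv (p : X) (a : pi1 p) : pi1 p :=
  homotopy_class (path_reverse (repr a)).

Lemma pi1_ind (p : X) (P : pi1 p -> Prop) :
  (forall f, P (homotopy_class f)) -> forall a, P a.
Proof. by move=> Pc a; rewrite -[a]reprK; exact: Pc. Qed.

Lemma homotopic_repr (p : X) (f : loop p) :
  path_homotopic (repr (homotopy_class f)) f.
Proof. by apply/homotopy_classP; exact: reprK. Qed.

Lemma pi1_mulE (p : X) (f g : loop p) :
  pi1_mul (homotopy_class f) (homotopy_class g) =
  homotopy_class (path_concat f g).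
Proof. by apply/homotopy_classP/path_concat_homotopic; exact: homotopic_repr. Qed.

Lemma pi1_invE (p : X) (f : loop p) :
  pi1_inv (homotopy_class f) = homotopy_class (path_reverse f).
Proof. by apply/homotopy_classP/path_reverse_homotopic; exact: homotopic_repr. Qed.

Lemma pi1_mulA (p : X) : associative (@pi1_mul p).
Proof.
elim/pi1_ind => f; elim/pi1_ind => g; elim/pi1_ind => k.
by rewrite !pi1_mulE; apply/homotopy_classP/path_concatA.
Qed.

Lemma pi1_1mul (p : X) : left_id (pi1_one p) (@pi1_mul p).
Proof.
by elim/pi1_ind => f; rewrite pi1_mulE; apply/homotopy_classP/path_concat1p.
Qed.

Lemma pi1_mul1 (p : X) : right_id (pi1_one p) (@pi1_mul p).
Proof.
by elim/pi1_ind => f; rewrite pi1_mulE; apply/homotopy_classP/path_concatp1.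
Qed.

Lemma pi1_Vmul (p : X) : left_inverse (pi1_one p) (@pi1_inv p) (@pi1_mul p).
Proof.
elim/pi1_ind => f; rewrite pi1_invE pi1_mulE.
exact/homotopy_classP/path_concatNp.
Qed.

Lemma pi1_mulV (p : X) : right_inverse (pi1_one p) (@pi1_inv p) (@pi1_mul p).
Proof.
elim/pi1_ind => f; rewrite pi1_invE pi1_mulE.
exact/homotopy_classP/path_concatpN.
Qed.

HB.instance Definition _ p := isGroup.Build (pi1 p) (@pi1_mulA p)
  (@pi1_1mul p) (@pi1_mul1 p) (@pi1_Vmul p) (@pi1_mulV p).

End fundamental_group.

Section epsilon_chains.
Context {R : realType} {X : metricType R} (eps : R).

(* A chain x_0, ..., x_n with x_0 = x_n = p is encoded by its tail
   x_1, ..., x_n. *)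
Definition eps_loop (p : X) (c : seq X) : bool :=
  path (fun x y => mdist x y < eps) p c && (last p c == p).

Definition chain (p : X) : Type := {c : seq X | eps_loop p c}.

HB.instance Definition _ p := Choice.copy (chain p) {c : seq X | eps_loop p c}.

Definition mk_chain (p : X) (c : seq X) (cP : eps_loop p c) : chain p :=
  exist (fun c => eps_loop p c) c cP.

Definition points (p : X) (c : chain p) : seq X := sval c.

(* Insertion of a point; inserting p in front of x_0 = p yields the same
   sequence as inserting it right after x_0. *)
Definition insertion (p : X) (c c' : chain p) : Prop :=
  exists s1 x s2, points c = s1 ++ s2 /\ points c' = s1 ++ x :: s2.

Definition eps_homotopic (p : X) : rel (chain p) :=
  fun c c' => `[< clos_refl_sym_trans _ (@insertion p) c c' >].

Lemma eps_homotopic_refl p : reflexive (@eps_homotopic p).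
Proof. by move=> c; apply/asboolP; exact: rst_refl. Qed.

Lemma eps_homotopic_sym p : symmetric (@eps_homotopic p).
Proof.
by move=> c d; apply/idP/idP => /asboolP cd; apply/asboolP; exact: rst_sym.
Qed.

Lemma eps_homotopic_trans p : transitive (@eps_homotopic p).
Proof.
by move=> d c e /asboolP cd /asboolP de; apply/asboolP; exact: rst_trans de.
Qed.

Canonical eps_homotopic_equiv p := EquivRel (@eps_homotopic p)
  (@eps_homotopic_refl p) (@eps_homotopic_sym p) (@eps_homotopic_trans p).

Definition pi_eps (p : X) : Type := {eq_quot eps_homotopic_equiv p}.

HB.instance Definition _ p := Quotient.on (pi_eps p).
HB.instance Definition _ p := Choice.on (pi_eps p).

Definition chain_class (p : X) (c : chain p) : pi_eps p := \pi_(pi_eps p) c.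

Lemma chain_classP (p : X) (c d : chain p) : chain_class c = chain_class d <->
  clos_refl_sym_trans _ (@insertion p) c d.
Proof. by split=> [/eqmodP/asboolP//|cd]; exact/eqmodP/asboolP. Qed.

Lemma nil_chain_subproof (p : X) : eps_loop p [::].
Proof. by rewrite /eps_loop/= eqxx. Qed.

Definition nil_chain (p : X) : chain p := mk_chain (nil_chain_subproof p).

Lemma cat_chain_subproof (p : X) (c d : chain p) :
  eps_loop p (points c ++ points d).
Proof.
rewrite /eps_loop cat_path last_cat.
have /andP[pc /eqP lc] := svalP c; have /andP[pd /eqP ld] := svalP d.
by rewrite lc pc pd ld eqxx.
Qed.

Definition cat_chain (p : X) (c d : chain p) : chain p :=
  mk_chain (cat_chain_subproof c d).

(* From p, x_1, ..., x_(n-1), p the reversed chain has the tail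
   x_(n-1), ..., x_1, p. *)
Lemma rev_chain_subproof (p : X) (c : chain p) :
  eps_loop p (rev (belast p (points c))).
Proof.
have /andP[pc /eqP lc] := svalP c.
rewrite /eps_loop -{1}lc rev_path.
rewrite (eq_path (e' := fun x y => mdist x y < eps)); last first.
  by move=> x y; rewrite metric_sym.
rewrite pc/=; case: (points c) => [|x s] /=; first by rewrite eqxx.
by rewrite rev_cons last_rcons.
Qed.

Definition rev_chain (p : X) (c : chain p) : chain p :=
  mk_chain (rev_chain_subproof c).

Lemma chain_eq (p : X) (c d : chain p) : points c = points d -> c = d.
Proof. exact: val_inj. Qed.

Lemma points_path (p : X) (c : chain p) :
  path (fun x y => mdist x y < eps) p (points c).
Proof. by have /andP[] := svalP c. Qed.

Lemma points_last (p : X) (c : chain p) : last p (points c) = p.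
Proof. by have /andP[_ /eqP] := svalP c. Qed.

Lemma clos_morph (p : X) (h : chain p -> chain p) :
  (forall c c', insertion c c' ->
    clos_refl_sym_trans _ (@insertion p) (h c) (h c')) ->
  forall c c', clos_refl_sym_trans _ (@insertion p) c c' ->
    clos_refl_sym_trans _ (@insertion p) (h c) (h c').
Proof.
move=> hP c c'; elim=> [||? ? _|c1 c2 c3 _ h12 _ h23]; [exact: hP|..].
- by move=> ?; exact: rst_refl.
- exact: rst_sym.
- exact: rst_trans h12 h23.
Qed.

Lemma cat_chain_homotopic (p : X) (c c' d d' : chain p) :
  chain_class c = chain_class c' -> chain_class d = chain_class d' ->
  chain_class (cat_chain c d) = chain_class (cat_chain c' d').
Proof.
move=> /chain_classP cc' /chain_classP dd'; apply/chain_classP.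
apply: (@rst_trans _ _ _ (cat_chain c' d)).
  refine (clos_morph (h := fun c => cat_chain c d) _ cc') => a a' [s1 [x [s2 [aE a'E]]]].
  apply: rst_step; exists s1, x, (s2 ++ points d).
  by rewrite /points/= -!/(points _) aE a'E -!catA.
refine (clos_morph (h := cat_chain c') _ dd') => a a' [s1 [x [s2 [aE a'E]]]].
apply: rst_step; exists (points c' ++ s1), x, s2.
by rewrite /points/= -!/(points _) aE a'E -!catA.
Qed.

Lemma rev_chain_homotopic (p : X) (c c' : chain p) :
  chain_class c = chain_class c' ->
  chain_class (rev_chain c) = chain_class (rev_chain c').
Proof.
move=> /chain_classP cc'; apply/chain_classP.
refine (clos_morph (h := @rev_chain p) _ cc') => {cc'} {}c {}c' [s1 [x [s2 [cE c'E]]]].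
apply: rst_step.
have := points_last c'; have := points_last c.
rewrite /insertion /points/= -!/(points _) cE c'E !last_cat.
case: s2 {cE c'E} => [/= s1p xp|y s2 _ _].
  exists [::], p, (rev (belast p s1)); rewrite cats0 xp; split=> //=.
  by rewrite cats1 belast_rcons lastI s1p rev_rcons.
exists (rev (belast y s2)), x, (rev (p :: s1)).
by rewrite !belast_cat/= -!(cat_rcons (last p s1)) -lastI !rev_cat (rev_cons x) cat_rcons.
Qed.

Lemma cat_rev_chain_null (p : X) (c : chain p) :
  chain_class (cat_chain c (rev_chain c)) = chain_class (nil_chain p).
Proof.
suff null s (cs : eps_loop p (s ++ rev (belast p s))) :
    path (fun x y => mdist x y < eps) p s ->
    chain_class (mk_chain cs) = chain_class (nil_chain p).
  have cs : eps_loop p (points c ++ rev (belast p (points c))).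
    exact: svalP (cat_chain c (rev_chain c)).
  rewrite -(null _ cs (points_path c)); congr chain_class.
  exact: chain_eq.
elim/last_ind: s cs => [|s y IH] cs.
  by move=> _; congr chain_class; exact: chain_eq.
rewrite rcons_path => /andP[ps sy].
have e0 : 0 < eps by rewrite (le_lt_trans _ sy) ?mdist_ge0.
have revE : rev (p :: s) = last p s :: rev (belast p s).
  by rewrite lastI rev_rcons.
have /andP[pr /eqP lr] : path (fun x y => mdist x y < eps) (last p s)
    (rev (belast p s)) && (last (last p s) (rev (belast p s)) == p).
  have := cs; rewrite {1}/eps_loop belast_rcons cat_path last_cat.
  by rewrite rcons_path revE/= last_rcons => /andP[/and3P[_ _ ->] ->].
have cs2 : eps_loop p (s ++ last p s :: rev (belast p s)).
  by rewrite /eps_loop cat_path ps/= mdistxx e0 pr last_cat/= lr eqxx.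
have cs3 : eps_loop p (s ++ rev (belast p s)).
  by rewrite /eps_loop cat_path ps pr/= last_cat lr eqxx.
rewrite -(IH cs3 ps); apply/chain_classP.
apply: (@rst_trans _ _ _ (mk_chain cs2)); apply/rst_sym/rst_step.
  exists s, y, (last p s :: rev (belast p s)).
  by rewrite /points/= belast_rcons revE cat_rcons.
by exists s, (last p s), (rev (belast p s)).
Qed.

Lemma rev_chainK (p : X) (c : chain p) : rev_chain (rev_chain c) = c.
Proof.
apply: chain_eq; rewrite /points/= -!/(points _).
have : rcons (belast p (rev (belast p (points c))))
    (last p (rev (belast p (points c)))) = rcons (rev (points c)) p.
  by rewrite -lastI -rev_rcons -rev_cons [p :: points c]lastI points_last.
by move/rcons_inj => [->]; rewrite revK.
Qed.

Definition pi_eps_one (p : X) : pi_eps p := chain_class (nil_chain p).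

Definition pi_eps_mul (p : X) (a b : pi_eps p) : pi_eps p :=
  chain_class (cat_chain (repr a) (repr b)).

Definition pi_eps_inv (p : X) (a : pi_eps p) : pi_eps p :=
  chain_class (rev_chain (repr a)).

Lemma pi_eps_ind (p : X) (P : pi_eps p -> Prop) :
  (forall c, P (chain_class c)) -> forall a, P a.
Proof. by move=> Pc a; rewrite -[a]reprK; exact: Pc. Qed.

Lemma pi_eps_mulE (p : X) (c d : chain p) :
  pi_eps_mul (chain_class c) (chain_class d) = chain_class (cat_chain c d).
Proof. by apply: cat_chain_homotopic; exact: reprK. Qed.

Lemma pi_eps_invE (p : X) (c : chain p) :
  pi_eps_inv (chain_class c) = chain_class (rev_chain c).
Proof. by apply: rev_chain_homotopic; exact: reprK. Qed.

Lemma pi_eps_mulA (p : X) : associative (@pi_eps_mul p).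
Proof.
elim/pi_eps_ind => c; elim/pi_eps_ind => d; elim/pi_eps_ind => e.
by rewrite !pi_eps_mulE; congr chain_class; apply: chain_eq; exact: catA.
Qed.

Lemma pi_eps_1mul (p : X) : left_id (pi_eps_one p) (@pi_eps_mul p).
Proof.
by elim/pi_eps_ind => c; rewrite pi_eps_mulE; congr chain_class; exact: chain_eq.
Qed.

Lemma pi_eps_mul1 (p : X) : right_id (pi_eps_one p) (@pi_eps_mul p).
Proof.
elim/pi_eps_ind => c; rewrite pi_eps_mulE; congr chain_class; apply: chain_eq.
exact: cats0.
Qed.

Lemma pi_eps_mulV (p : X) :
  right_inverse (pi_eps_one p) (@pi_eps_inv p) (@pi_eps_mul p).
Proof.
by elim/pi_eps_ind => c; rewrite pi_eps_invE pi_eps_mulE cat_rev_chain_null.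
Qed.

Lemma pi_eps_Vmul (p : X) :
  left_inverse (pi_eps_one p) (@pi_eps_inv p) (@pi_eps_mul p).
Proof.
elim/pi_eps_ind => c; rewrite pi_eps_invE pi_eps_mulE -{2}(rev_chainK c).
by rewrite cat_rev_chain_null.
Qed.

HB.instance Definition _ p := isGroup.Build (pi_eps p) (@pi_eps_mulA p)
  (@pi_eps_1mul p) (@pi_eps_mul1 p) (@pi_eps_Vmul p) (@pi_eps_mulV p).

End epsilon_chains.

Section strong_chains.
Context {R : realType} {X : metricType R}.

(* The chain f t_0, ..., f t_n for the partition 0 = t_0 < ... < t_n = 1,
   where ts and c consist of the terms of index at least 1. *)
Definition strong_chain (eps : R) (f : unitI R -> X) (c : seq X) : Prop :=
  exists ts : seq (unitI R),
    [/\ itv_partition 0 1 (map unit_val ts), c = map f ts &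
      forall i, (i < size ts)%N ->
        let a := nth zero (zero :: ts) i in
        let b := nth zero ts i in
        f @` [set t | unit_val a <= unit_val t <= unit_val b]
          `<=` ball (f a) eps `&` ball (f b) eps].

(* For 0 < eps, the set below is a singleton, hence the default value plays no
   role. *)
Definition h_eps (eps : R) (p : X) (a : pi1 p) : pi_eps eps p :=
  xget 1%g [set chain_class c | c in [set c : chain eps p |
    exists2 f : loop p, homotopy_class f = a & strong_chain eps f (points c)]].

Definition K_eps (eps : R) (p : X) : set (pi1 p) :=
  [set a | h_eps eps a = 1%g].

Definition pi_cl (p : X) : set (pi1 p) :=
  \bigcap_(eps in [set eps : R | 0 < eps]) @K_eps eps p.

End strong_chains.

Section group_quotient.
Variables (G : groupType) (N : set G).

Definition left_coset (x : G) : set G := [set (x * n)%g | n in N].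

Definition coset_eq : rel G := fun x y => `[< left_coset x = left_coset y >].

Lemma coset_eq_refl : reflexive coset_eq.
Proof. by move=> x; exact/asboolP. Qed.

Lemma coset_eq_sym : symmetric coset_eq.
Proof. by move=> x y; apply/idP/idP => /asboolP xy; exact/asboolP. Qed.

Lemma coset_eq_trans : transitive coset_eq.
Proof.
by move=> y x z /asboolP xy /asboolP yz; apply/asboolP; exact: etrans yz.
Qed.

Canonical coset_equiv :=
  EquivRel coset_eq coset_eq_refl coset_eq_sym coset_eq_trans.

Definition cosets : Type := {eq_quot coset_equiv}.

HB.instance Definition _ := Quotient.on cosets.
HB.instance Definition _ := Choice.on cosets.

Definition coset_class (x : G) : cosets := \pi_cosets x.

Definition cosets_one : cosets := coset_class 1.
Definition cosets_inv (a : cosets) : cosets := coset_class (repr a)^-1.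
Definition cosets_mul (a b : cosets) : cosets := coset_class (repr a * repr b).

End group_quotient.

Definition pi1_bar (R : realType) (X : metricType R) (p : X) : topologicalType :=
  quotient_topology (cosets (@pi_cl R X p) : quotType (pi1 p)).

(* The group laws are part of the property because [cosets N], whose operations
   are computed on representatives, is a group only when N is normal. *)
Definition quasitopological_group (T : topologicalType)
    (e : T) (inv : T -> T) (mul : T -> T -> T) : Prop :=
  [/\ associative mul, left_id e mul, right_id e mul,
      left_inverse e inv mul & right_inverse e inv mul] /\
  [/\ continuous inv, forall a, continuous (mul a) &
      forall b, continuous (mul^~ b)].

Definition discrete_space (T : topologicalType) : Prop :=
  forall A : set T, open A.

Section geodesic.
Context {R : realType} {X : metricType R}.

Definition path_length (f : unitI R -> X) : \bar R :=
  ereal_sup [set (\sum_(i < size ts)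
      mdist (f (nth zero (zero :: ts) i)) (f (nth zero ts i)))%:E
    | ts in [set ts : seq (unitI R) | itv_partition 0 1 (map unit_val ts)]].

Definition geodesic_space : Prop :=
  forall x y : X, exists f : {path unitI R from x to y in X},
    path_length f = (mdist x y)%:E.

End geodesic.
Arguments geodesic_space {R} X.

Section covers.

Definition homeomorphic_via {Y X : topologicalType} (f : Y -> X)
    (V : set Y) (U : set X) : Prop :=
  [/\ f @` V = U, {within V, continuous f} &
      exists g : X -> Y, {within U, continuous g} /\ {in V, cancel f g}].

Definition evenly_covered {Y X : topologicalType} (f : Y -> X) (U : set X) :
    Prop :=
  exists F : set (set Y),
    [/\ forall V, F V -> open V, trivIset F id, f @^-1` U = \bigcup_(V in F) V &
        forall V, F V -> homeomorphic_via f V U].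

Definition is_cover {Y X : topologicalType} (f : Y -> X) : Prop :=
  [/\ connected [set: Y], continuous f, range f = [set: X] &
      forall x, exists U, [/\ open U, U x & evenly_covered f U]].

Definition is_universal_cover {Y X : topologicalType} (f : Y -> X) : Prop :=
  is_cover f /\
  forall (Z : topologicalType) (g : Z -> X), is_cover g ->
    exists h : Y -> Z, is_cover h /\ g \o h = f.

Definition has_universal_cover (X : topologicalType) : Prop :=
  exists (Y : topologicalType) (f : Y -> X), is_universal_cover f.

End covers.

(* Main.v *)
From HB Require Import structures.
From Stdlib Require Import Relation_Operators.
From Stdlib Require Setoid Morphisms.
Require Import Defs.
From mathcomp Require Import all_boot all_order all_algebra generic_quotient.
From mathcomp Require Import all_classical all_reals all_analysis.
From mathcomp Require Import wedge_sigT continuous_path lra.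

Set Implicit Arguments.
Unset Strict Implicit.
Unset Printing Implicit Defensive.

Import Order.TTheory GRing.Theory Num.Theory.
Import numFieldTopology.Exports numFieldNormedType.Exports.
Local Open Scope classical_set_scope.
Local Open Scope ring_scope.
Local Open Scope quotient_scope.

(** Two facts carry the proof.

    First, all strong chains along a path are homotopic as epsilon-chains, and
    uniformly close paths with the same ends have homotopic strong chains
    ([strong_chain_unique], [strong_chain_near]). Since the unit interval is
    connected, homotopic paths then have homotopic strong chains, so that [h_eps]
    is a homomorphism whose fibres are open in the topological fundamental group
    ([h_epsM], [h_eps_open]). Hence each [K_eps] is an open normal subgroup,
    [pi_cl] is normal, and the cosets of [pi_cl] are intersections of cosets of
    the clopen subgroups [K_eps]: the quotient is T1. Its translations and its
    inversion are continuous because concatenation with a fixed loop and reversal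
    are continuous for the uniform topology.

    Second, covers and open normal subgroups correspond as follows. An open normal
    subgroup [N] defines a cover whose points are the paths from the base point
    modulo [N] and in which a loop can lift to a closed path only if its class is
    in [N] ([cover_projP], [loop_lift_closed]). Openness gives local triviality:
    loops near a path that runs to [x] and back are in [N], hence so is every
    small loop at [x], conjugated by a path from the base point. Conversely, by
    compactness a cover evenly covers all balls of some radius, so that its points
    can be transported along epsilon-chains for some epsilon; this transport is
    invariant under homotopies of chains, so that loops in [K_eps] act trivially
    on the fibre ([cover_transport], [transport_homotopic]).

    If there is a universal cover, let epsilon be its scale. It maps to the covers
    defined by all subgroups [K_eps], so that a loop in [K_eps] for the scale
    epsilon, which acts trivially on the universal cover, is in all of them:
    [pi_cl] is one of the [K_eps], thus open, and the quotient is discrete. If the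
    quotient is discrete, then [pi_cl] is open and defines a cover. It is
    universal because [pi_cl] acts trivially on the fibre of any cover, which
    makes the end of the transport along a path well defined on points of the cover
    of [pi_cl] ([end_map]); a map between covers of a locally connected space is
    again a cover ([cover_factor]). *)

(** * Connectedness, compactness and uniform continuity *)

(** Continuous induction. The last two hypotheses say that [P] cuts out a
    relatively open and closed part of [A]. *)
Lemma connected_ind {T : topologicalType} (A : set T) (P : T -> Prop) a :
  connected A -> A a -> P a ->
  (forall b, A b -> P b -> \forall c \near b, A c -> P c) ->
  (forall b, A b -> ~ P b -> \forall c \near b, A c -> ~ P c) ->
  forall b, A b -> P b.
Proof.
move=> cA Aa Pa oP cP; suff <- : A `&` P = A by move=> b [].
apply: cA; first by exists a.
- exists (interior [set c | A c -> P c]); first exact: open_interior.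
  apply/seteqP; split=> b [Ab]; first by move=> Pb; split=> //; exact: oP.
  by move/interior_subset => /(_ Ab).
- exists (~` interior [set c | A c -> ~ P c]).
    exact/open_closedC/open_interior.
  apply/seteqP; split=> b [Ab] => [Pb|nPb].
    by split=> // /interior_subset /(_ Ab).
  by split=> //; apply: contrapT => /(cP _ Ab).
Qed.

Section unit_interval.
Context {R : realType}.
Implicit Types s t : unitI R.

Lemma range_clamp : @clamp R @` `[(0 : R), 1] = [set: unitI R].
Proof.
apply/seteqP; split=> // t _; exists (unit_val t); last exact: clampK.
by rewrite /= in_itv/= unit_valP.
Qed.

Lemma unitI_connected : connected [set: unitI R].
Proof.
rewrite -range_clamp; apply: connected_continuous_connected.
  exact: segment_connected.
by apply: continuous_subspaceT; exact: clamp_continuous.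
Qed.

Lemma unitI_compact : compact [set: unitI R].
Proof.
rewrite -range_clamp; apply: continuous_compact; [|exact: segment_compact].
by apply: continuous_subspaceT; exact: clamp_continuous.
Qed.

Lemma unit_nbhsP t (P : set (unitI R)) :
  nbhs t P <-> exists2 d, 0 < d &
    forall s, `|unit_val s - unit_val t| < d -> P s.
Proof.
split=> [tP|[d d0 dP]]; last first.
  have : nbhs t (unit_val @^-1` ball (unit_val t) d).
    by apply: unit_val_continuous; exact: nbhsx_ballx.
  by apply: filterS => s; rewrite /= /ball/= distrC => /dP.
have : nbhs (unit_val t) (@clamp R @^-1` P).
  by apply: clamp_continuous; rewrite clampK.
move=> /nbhs_ballP[d/= d0 dP]; exists d => // s st.
by rewrite -[s]clampK; apply: dP; rewrite /ball/= distrC.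
Qed.

End unit_interval.

Section metric.
Context {R : realType} {X : metricType R}.
Implicit Types x y z : X.

Lemma mdist_tri x y z (a b : R) :
  mdist x y < a -> mdist y z < b -> mdist x z < a + b.
Proof. by move=> xy yz; rewrite (le_lt_trans (metric_triangle x y z)) ?ltrD. Qed.

Lemma in_ball x (r : R) y : ball x r y = (mdist x y < r) :> Prop.
Proof. by rewrite ballEmdist. Qed.

Lemma nbhs_metricP x (P : set X) :
  nbhs x P <-> exists2 r, 0 < r & forall y, mdist x y < r -> P y.
Proof.
split=> [/nbhs_ballP[r/= r0 rP]|[r r0 rP]].
  by exists r => // y xy; apply: rP; rewrite in_ball.
by apply/nbhs_ballP; exists r => //= y; rewrite in_ball => /rP.
Qed.

Lemma metric_ball_open x (r : R) : open (ball x r).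
Proof.
rewrite openE => y; rewrite in_ball => xy; apply/nbhs_metricP.
exists (r - mdist x y); first by rewrite subr_gt0.
move=> z yz; rewrite in_ball; have := metric_triangle x y z.
by lra.
Qed.

(** Applied with [Q A] saying that [A] is contained in an evenly covered set, this
    produces the scale of a cover. *)
Lemma lebesgue_number (Q : set X -> Prop) : compact [set: X] ->
  (forall A B, A `<=` B -> Q B -> Q A) ->
  (forall x, exists2 r, 0 < r & Q (ball x r)) ->
  exists2 r, 0 < r & forall x, Q (ball x r).
Proof.
move=> /compact_near_coveringP cX QS Qx.
have : \forall r \near (0 : R)^'+, [set: X] `<=` (fun x => Q (ball x r)).
  apply: cX => x _; have [r r0 Qr] := Qx x.
  have r2 : 0 < r / 2 by exact: divr_gt0.
  exists (ball x (r / 2), [set e | e <= r / 2]) => /=.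
    by split; [exact: nbhsx_ballx|exact: nbhs_right_le].
  move=> [y e] /= []; rewrite in_ball => xy er; apply: QS Qr => z; rewrite !in_ball.
  by move=> yz; rewrite (splitr r); apply: mdist_tri xy (lt_le_trans yz er).
move=> /(filterI (nbhs_right_gt (0 : R))) /filter_ex[r [r0 rQ]].
by exists r => // x; exact: rQ.
Qed.

(** The tube lemma: the unit interval is compact, so that the slices of [H] vary
    continuously for the uniform distance. *)
Lemma near_uniform {T : topologicalType} (H : unitI R * T -> X) t (e : R) :
  continuous H -> 0 < e ->
  \forall t' \near t, forall s, mdist (H (s, t)) (H (s, t')) < e.
Proof.
move=> cH e0; have /compact_near_coveringP cI := @unitI_compact R.
have : \forall t' \near t,
    [set: unitI R] `<=` (fun s => mdist (H (s, t)) (H (s, t')) < e).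
  apply: cI => s _.
  have He : nbhs (H (s, t)) (ball (H (s, t)) (e / 2)).
    by apply: nbhsx_ballx; exact: divr_gt0.
  have [[P Q]/= [sP tQ] PQ] := cH _ _ He.
  exists (P, Q) => //= -[s' t'] /= [Ps' Qt'].
  rewrite (splitr e); apply: (@mdist_tri _ (H (s, t))).
    have := PQ (s', t); rewrite /= in_ball metric_sym; apply.
    by split=> //=; exact: nbhs_singleton.
  by have := PQ (s', t'); rewrite /= in_ball; exact.
by apply: filterS => t' + s => /(_ s I).
Qed.

Lemma unit_uniform_continuous (f : unitI R -> X) (e : R) :
  continuous f -> 0 < e -> exists2 d, 0 < d &
    forall s t, `|unit_val s - unit_val t| < d -> mdist (f s) (f t) < e.
Proof.
move=> cf e0.
(* Uniform continuity of [f] is uniform closeness to [f] of its small translates. *)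
have cH : continuous (fun u : unitI R * R => f (clamp (unit_val u.1 + u.2))).
  move=> u; apply: (continuous_comp (f := fun u => clamp (unit_val u.1 + u.2))
    (g := f)); last exact: cf.
  apply: clamp_comp_continuous => v; apply: cvgD; last exact: cvg_snd.
  apply: (continuous_comp (f := fst)); first exact: cvg_fst.
  exact: unit_val_continuous.
have /nbhs_ballP[d/= d0 dP] := near_uniform (0 : R) cH e0.
exists d => // s t st.
have := dP (unit_val t - unit_val s).
rewrite /ball/= sub0r normrN distrC st => /(_ isT s) /=.
by rewrite addr0 addrC subrK !clampK.
Qed.

End metric.

(** * Homotopies of open chains *)

Section open_chains.
Context {R : realType} {X : metricType R} (eps : R).
Implicit Types (x y : X) (c d : seq X).

Definition eps_adjacent : rel X := fun x y => mdist x y < eps.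

(** Chains that need not close up, encoded by their tails as in [eps_loop]. They
    are needed to compare the chains along two paths piece by piece. *)
Definition open_insertion x c c' : Prop :=
  [/\ path eps_adjacent x c, path eps_adjacent x c', last x c = last x c' &
    exists s1 y s2, c = s1 ++ s2 /\ c' = s1 ++ y :: s2].

Definition open_homotopic x := clos_refl_sym_trans _ (open_insertion x).

Lemma open_homotopic_ins x s1 y s2 :
  path eps_adjacent x (s1 ++ s2) -> path eps_adjacent x (s1 ++ y :: s2) ->
  last x (s1 ++ s2) = last x (s1 ++ y :: s2) ->
  open_homotopic x (s1 ++ s2) (s1 ++ y :: s2).
Proof. by move=> p1 p2 l12; apply: rst_step; split=> //; exists s1, y, s2. Qed.

Lemma open_homotopic_last x c c' :
  open_homotopic x c c' -> last x c = last x c'.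
Proof. by elim=> [? ? []|//|? ? _ ->|? ? ? _ -> _ ->]. Qed.

Lemma open_homotopic_path x c c' :
  open_homotopic x c c' -> path eps_adjacent x c = path eps_adjacent x c'.
Proof. by elim=> [? ? [-> ->]|//|? ? _ ->|? ? ? _ -> _ ->]. Qed.

Lemma open_homotopic_map x y (k : seq X -> seq X) :
  (forall c c', open_insertion x c c' -> open_homotopic y (k c) (k c')) ->
  forall c c', open_homotopic x c c' -> open_homotopic y (k c) (k c').
Proof.
move=> kP c c'; elim=> [|?|? ? _|? ? ? _ h1 _ h2]; first exact: kP.
- exact: rst_refl.
- exact: rst_sym.
- exact: rst_trans h1 h2.
Qed.

Lemma open_homotopic_catl x s c c' : path eps_adjacent x s ->
  open_homotopic (last x s) c c' -> open_homotopic x (s ++ c) (s ++ c').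
Proof.
move=> ps; apply: (@open_homotopic_map _ _ (cat s)) => {}c {}c'.
move=> [p1 p2 l12 [s1 [y [s2 [cE c'E]]]]].
apply: rst_step; split; rewrite ?cat_path ?last_cat ?ps//.
by exists (s ++ s1), y, s2; rewrite cE c'E !catA.
Qed.

Lemma open_homotopic_cons x y c c' : eps_adjacent x y ->
  open_homotopic y c c' -> open_homotopic x (y :: c) (y :: c').
Proof. by move=> xy; apply: (@open_homotopic_catl x [:: y]); rewrite /= xy. Qed.

Lemma open_homotopic_catr x c c' d : path eps_adjacent (last x c) d ->
  open_homotopic x c c' -> open_homotopic x (c ++ d) (c' ++ d).
Proof.
move=> pd cc'; move: pd; elim: cc' => [{}c {}c'|{}c _|{}c {}c' cc' h pd|].
- move=> [p1 p2 l12 [s1 [y [s2 [cE c'E]]]]] pd.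
  apply: rst_step; split; rewrite ?cat_path ?last_cat -?l12 ?p1 ?p2 ?pd//.
  by exists s1, y, (s2 ++ d); rewrite cE c'E -!catA.
- exact: rst_refl.
- by apply/rst_sym/h; rewrite (open_homotopic_last cc').
- move=> c1 c2 c3 h12 IH12 _ IH23 pd; apply: rst_trans (IH12 pd) (IH23 _).
  by rewrite -(open_homotopic_last h12).
Qed.

(** Insertions fix both ends and the step size, so that all the chains of an open
    homotopy between closed chains are closed. *)
Lemma open_homotopicP (p : X) (c c' : chain eps p) :
  chain_class c = chain_class c' <-> open_homotopic p (points c) (points c').
Proof.
split=> [/chain_classP|cc'].
  elim=> [{}c {}c' [s1 [y [s2 [cE c'E]]]]|?|? ? _|? ? ? _ h12 _ h23].
  - apply: rst_step; split; rewrite ?points_path ?points_last//.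
    by exists s1, y, s2.
  - exact: rst_refl.
  - exact: rst_sym.
  - exact: rst_trans h12 h23.
apply/chain_classP; case: c c' cc' => [c cP] [c' c'P]; rewrite /points/= => cc'.
elim: cc' cP c'P => {c c'} [c c' [_ _ _ cc']|c|c c' _ h|c1 c2 c3 h12 IH12 _ IH23].
- by move=> cP c'P; apply: rst_step; exact: cc'.
- by move=> cP cP'; rewrite (Prop_irrelevance cP cP'); exact: rst_refl.
- by move=> cP c'P; exact/rst_sym.
- move=> c1P c3P.
  have c2P : eps_loop eps p c2.
    move: c1P; rewrite /eps_loop (open_homotopic_last h12).
    by rewrite (open_homotopic_path h12).
  exact: rst_trans (IH12 c1P c2P) (IH23 c2P c3P).
Qed.

End open_chains.

(** * Strong chains along paths *)

Section strong_chain_homotopies.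
Context {R : realType} {X : metricType R} (eps : R).
Implicit Types (f g : unitI R -> X) (s t u : unitI R).

(** The condition that [strong_chain] imposes on two consecutive terms of a
    partition. Stated as a relation, it turns the partitions of strong chains into
    instances of [path]. *)
Definition tame f : rel (unitI R) := fun s t => (unit_val s < unit_val t) &&
  `[< forall u, unit_val s <= unit_val u <= unit_val t ->
      mdist (f s) (f u) < eps /\ mdist (f t) (f u) < eps >].

Lemma strong_chainP f c : strong_chain eps f c <->
  exists2 ts, path (tame f) zero ts /\ last zero ts = one & c = map f ts.
Proof.
split=> [[ts [[pts lts] cE fts]]|[ts [pts lts] ->]]; exists ts => //.
  split; last first.
    apply: unit_val_inj; rewrite unit_val1; move/eqP: lts.
    by rewrite -{1}(@unit_val0 R) last_map.
  apply/(pathP zero) => i its; apply/andP; split.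
    have nE us j : nth 0 (map unit_val us) j = unit_val (nth (@zero (unitI R)) us j).
      have [jus|jus] := ltnP j (size us); first by rewrite (nth_map zero).
      by rewrite !nth_default ?size_map ?unit_val0.
    have /(pathP 0)/(_ i) := pts; rewrite size_map => /(_ its).
    have -> : 0 :: map unit_val ts = map unit_val (zero :: ts).
      by rewrite /= unit_val0.
    by rewrite !nE.
  apply/asboolP => u su; have [|] := fts i its (f u); first by exists u.
  by rewrite !in_ball.
split=> //.
  split; rewrite -(@unit_val0 R); last by rewrite last_map lts unit_val1.
  by rewrite path_map; apply: sub_path pts => s t /andP[].
move=> i its /= _ [u su <-].
have /(pathP zero)/(_ i its)/andP[_ /asboolP/(_ u su)[? ?]] := pts.
by split; rewrite in_ball.
Qed.

Lemma tame_adjacent f s t : tame f s t -> eps_adjacent eps (f s) (f t).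
Proof.
by move=> /andP[st /asboolP/(_ t)[]//]; rewrite (ltW st) lexx.
Qed.

Lemma strong_chain_path f c :
  strong_chain eps f c -> path (eps_adjacent eps) (f zero) c.
Proof.
move=> /strong_chainP[ts [pts _] ->]; rewrite path_map.
by apply: sub_path pts => s t; exact: tame_adjacent.
Qed.

Lemma strong_chain_last f c :
  strong_chain eps f c -> last (f zero) c = f one.
Proof. by move=> /strong_chainP[ts [_ <-] ->]; rewrite last_map. Qed.

Lemma strong_chain_ex f : continuous f -> 0 < eps ->
  exists c, strong_chain eps f c.
Proof.
move=> cf e0; have [d d0 fd] := unit_uniform_continuous cf e0.
suff H n s : 1 - unit_val s <= n%:R * (d / 2) ->
    exists2 ts, path (tame f) s ts & last s ts = one.
  have [//|ts pts lts] := H (Num.truncn ((d / 2)^-1)).+1 zero.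
    rewrite unit_val0 subr0 -ler_pdivrMr ?divr_gt0// mul1r.
    by apply/ltW; rewrite -truncn_le_nat.
  by exists (map f ts); apply/strong_chainP; exists ts.
elim: n s => [|n IH] s.
  rewrite mul0r subr_le0 => s1; exists [::] => //=; apply: unit_val_inj.
  by rewrite unit_val1; apply/eqP; rewrite eq_le s1 andbT; case/andP: (unit_valP s).
have [->|s1] := eqVneq s one; first by exists [::].
have {}s1 : unit_val s < 1.
  rewrite lt_neqAle; case/andP: (unit_valP s) => _ ->; rewrite andbT.
  by apply: contraNneq s1 => s1; apply/eqP/unit_val_inj; rewrite unit_val1.
rewrite -natr1 mulrDl mul1r => sn.
pose r := Num.min (unit_val s + d / 2) 1.
have rE : unit_val (clamp r) = r.
  have /andP[s0 _] := unit_valP s.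
  by rewrite clampE// /r ge_min lexx orbT le_min ler01 andbT; lra.
have rd : r <= unit_val s + d / 2 by rewrite /r ge_min lexx.
have [ts pts lts] : exists2 ts, path (tame f) (clamp r) ts &
    last (clamp r) ts = one.
  have n0 : 0 <= n%:R * (d / 2) by rewrite mulr_ge0// divr_ge0// ltW.
  by apply: IH; rewrite rE /r; case: (leP (unit_val s + d / 2) 1) => _; lra.
exists (clamp r :: ts) => //=; rewrite pts andbT; apply/andP; split.
  by rewrite rE /r lt_min s1 andbT; lra.
by apply/asboolP => u; rewrite rE => /andP[su ur]; split; apply: fd;
  rewrite ?rE ltr_norml; apply/andP; split; lra.
Qed.

(** Two partitions are merged one point at a time: if the next point [t] of one of
    them precedes the next point [t'] of the other, then [t] lies in a part of the
    path that stays close to [f t'], so that [f t] may be inserted before [f t'].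
    Only the distance to the right end of each part matters, and this one-sided
    condition survives when the part from [s] to [t'] is cut down to the part from
    [t] to [t'], which makes the induction work. *)
Lemma strong_chain_merge f s ts ts' :
  path (fun s t => (unit_val s < unit_val t) && `[< forall u,
    unit_val s <= unit_val u <= unit_val t -> mdist (f u) (f t) < eps >]) s ts ->
  path (fun s t => (unit_val s < unit_val t) && `[< forall u,
    unit_val s <= unit_val u <= unit_val t -> mdist (f u) (f t) < eps >]) s ts' ->
  last s ts = last s ts' ->
  open_homotopic eps (f s) (map f ts) (map f ts').
Proof.
set r : rel (unitI R) := (X in path X); move: {2}(_ + _)%N (leqnn (size ts + size ts')).
have r_adj a b : r a b -> eps_adjacent eps (f a) (f b).
  by move=> /andP[ab /asboolP/(_ a)]; rewrite lexx (ltW ab); exact.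
have r_le a us : path r a us -> unit_val a <= unit_val (last a us).
  elim: us a => //= b us IH a /andP[/andP[/ltW ab _] /IH]; exact: le_trans.
have r_lt a b us : path r a (b :: us) -> a <> last b us.
  by move=> /= /andP[/andP[ab _] /r_le bus] aE; move: ab; rewrite aE ltNge bus.
move=> n; elim: n s ts ts' => [|n IH] s [|t ts] [|t' ts'] //=.
- by move=> *; exact: rst_refl.
- by move=> *; exact: rst_refl.
- by move=> _ _ p l; case: (r_lt s t' ts').
- by move=> _ p _ l; case: (r_lt s t ts).
have step a b us b' us' : (size us + size (b' :: us') <= n)%N ->
    path r a (b :: us) -> path r a (b' :: us') -> last b us = last b' us' ->
    unit_val b < unit_val b' ->
    open_homotopic eps (f a) (map f (b :: us)) (map f (b' :: us')).
  move=> sz /= /andP[ab pus] /andP[/andP[ab' /asboolP fb'] pus'] l bb'.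
  have rbb' : r b b'.
    rewrite /r bb'/=; apply/asboolP => u /andP[bu ub']; apply: fb'.
    by rewrite ub' andbT (le_trans _ bu)// ltW//; case/andP: ab.
  apply: (@rst_trans _ _ _ (f b :: f b' :: map f us')).
    apply: open_homotopic_cons; first exact: r_adj.
    by apply: (IH b us (b' :: us')) => //=; rewrite rbb'.
  apply/rst_sym/(@open_homotopic_ins _ _ _ _ [::]) => //=.
    apply/andP; split; last first.
      by rewrite path_map; apply: sub_path pus' => ? ?; exact: r_adj.
    by apply: r_adj; rewrite /r ab'; exact/asboolP.
  rewrite (r_adj _ _ ab) (r_adj _ _ rbb')/=.
  by rewrite path_map; apply: sub_path pus' => ? ?; exact: r_adj.
rewrite addSn addnS ltnS => sz pts pts' l.
have [tt'|tt'|tt'] := ltgtP (unit_val t) (unit_val t').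
- by apply: step => //; rewrite /= addnS.
- by apply/rst_sym/step => //; rewrite addnC addSn.
- have {}tt' := unit_val_inj tt'; rewrite -tt' in pts' l *.
  case/andP: pts => st pts; case/andP: pts' => _ pts'.
  apply: open_homotopic_cons; first exact: r_adj.
  by apply: IH => //; rewrite ltnW.
Qed.

Lemma strong_chain_unique f c c' : strong_chain eps f c ->
  strong_chain eps f c' -> open_homotopic eps (f zero) c c'.
Proof.
move=> /strong_chainP[ts [pts lts] ->] /strong_chainP[ts' [pts' lts'] ->].
apply: strong_chain_merge; last by rewrite lts lts'.
- apply: sub_path pts => s t /andP[-> /asboolP ft]/=.
  by apply/asboolP => u /ft[_]; rewrite metric_sym.
- apply: sub_path pts' => s t /andP[-> /asboolP ft]/=.
  by apply/asboolP => u /ft[_]; rewrite metric_sym.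
Qed.

Lemma strong_chain1 f : (forall t, mdist (f zero) (f t) < eps) ->
  (forall t, mdist (f one) (f t) < eps) -> strong_chain eps f [:: f one].
Proof.
move=> f0 f1; apply/strong_chainP; exists [:: one] => //; split=> //=.
by rewrite andbT /tame unit_val0 unit_val1 ltr01/=; apply/asboolP.
Qed.

Lemma concat_funL f g t : unit_val t <= 2^-1 ->
  concat_fun f g t = f (clamp (2 * unit_val t)).
Proof. by rewrite /concat_fun => t2; rewrite ifT. Qed.

Lemma concat_funR f g t : f one = g zero -> 2^-1 <= unit_val t ->
  concat_fun f g t = g (clamp (2 * unit_val t - 1)).
Proof.
move=> fg; rewrite /concat_fun; case: ltgtP => // <- _.
by rewrite divff// subrr.
Qed.

Lemma strong_chain_concat f g c d : f one = g zero ->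
  strong_chain eps f c -> strong_chain eps g d ->
  strong_chain eps (concat_fun f g) (c ++ d).
Proof.
move=> fg /strong_chainP[ts [pts lts] ->] /strong_chainP[us [pus lus] ->].
pose a (t : unitI R) := clamp (2^-1 * unit_val t).
pose b (t : unitI R) := clamp (2^-1 * unit_val t + 2^-1).
have aE t : unit_val (a t) = 2^-1 * unit_val t.
  by have /andP[t0 t1] := unit_valP t; rewrite clampE//; lra.
have bE t : unit_val (b t) = 2^-1 * unit_val t + 2^-1.
  by have /andP[t0 t1] := unit_valP t; rewrite clampE//; lra.
have fa t : concat_fun f g (a t) = f t.
  have /andP[t0 t1] := unit_valP t; rewrite concat_funL aE; last by lra.
  by rewrite mulrA divff// mul1r clampK.
have gb t : concat_fun f g (b t) = g t.
  have /andP[t0 t1] := unit_valP t; rewrite concat_funR// bE; last by lra.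
  by rewrite mulrDr mulrA divff// mul1r addrK clampK.
have ab : a one = b zero.
  by apply: unit_val_inj; rewrite aE bE unit_val0 unit_val1; lra.
apply/strong_chainP; exists (map a ts ++ map b us); last first.
  by rewrite map_cat -!map_comp; congr (_ ++ _); apply: eq_map => t /=.
have a0 : zero = a zero.
  by apply: unit_val_inj; rewrite aE unit_val0 mulr0.
rewrite a0 cat_path last_cat last_map lts ab last_map lus; split; last first.
  by apply: unit_val_inj; rewrite bE unit_val1; lra.
rewrite !path_map; apply/andP; split.
  apply: sub_path pts => s t /andP[st /asboolP fst].
  rewrite /tame/= !aE; apply/andP; split; first by lra.
  apply/asboolP => u su; have /andP[t0 t1] := unit_valP t.
  have /andP[s0 s1] := unit_valP s.
  rewrite !fa concat_funL; last by lra.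
  by apply: fst; rewrite clampE; lra.
apply: sub_path pus => s t /andP[st /asboolP gst].
rewrite /tame/= !bE; apply/andP; split; first by lra.
apply/asboolP => u su; have /andP[t0 t1] := unit_valP t.
have /andP[s0 s1] := unit_valP s.
rewrite !gb concat_funR//; last by lra.
by apply: gst; rewrite clampE; lra.
Qed.

(** The chain along [f] is deformed to the chain along [g] from left to right:
    insert [g t] between [f s] and [f t], then remove [f s]. The bound [eps / 3]
    keeps the diagonals of this ladder below [eps]. *)
Lemma ladder_homotopic f g s ts :
  path (fun s t => mdist (f s) (f t) < eps / 3) s ts ->
  (forall t, mdist (f t) (g t) < eps / 3) ->
  f (last s ts) = g (last s ts) ->
  open_homotopic eps (g s) (f s :: map f ts) (map g ts).
Proof.
move=> + fg; elim: ts s => [|t ts IH] s /=.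
  move=> _ fgs; apply/rst_sym/(@open_homotopic_ins _ _ _ _ [::]) => //=.
  rewrite /eps_adjacent metric_sym andbT.
  by have := fg s; have := mdist_ge0 (f s) (g s); lra.
move=> /andP[st pts] l.
have e0 : 0 < eps by have := fg s; have := mdist_ge0 (f s) (g s); lra.
have fs : eps_adjacent eps (g s) (f s).
  by rewrite /eps_adjacent metric_sym; have := fg s; lra.
have ft : eps_adjacent eps (g t) (f t).
  by rewrite /eps_adjacent metric_sym; have := fg t; lra.
have fst : eps_adjacent eps (f s) (f t) by rewrite /eps_adjacent; lra.
have fgst : eps_adjacent eps (f s) (g t).
  by have := mdist_tri st (fg t); rewrite /eps_adjacent; lra.
have gst : eps_adjacent eps (g s) (g t).
  have gfs : mdist (g s) (f s) < eps / 3 by rewrite metric_sym.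
  by have := mdist_tri gfs (mdist_tri st (fg t)); rewrite /eps_adjacent; lra.
have pf : path (eps_adjacent eps) (f t) (map f ts).
  by rewrite path_map; apply: sub_path pts => a b; rewrite /eps_adjacent/=; lra.
apply: (@rst_trans _ _ _ [:: f s, g t, f t & map f ts]).
  by apply: (@open_homotopic_ins _ _ _ _ [:: f s]); rewrite /= ?fs ?fst ?fgst ?ft ?pf.
apply: (@rst_trans _ _ _ [:: g t, f t & map f ts]).
  apply/rst_sym/(@open_homotopic_ins _ _ _ _ [::]) => //=;
  by rewrite ?fs ?fst ?fgst ?ft ?pf ?gst.
by apply: open_homotopic_cons => //; exact: IH.
Qed.

End strong_chain_homotopies.

Section strong_chain_invariance.
Context {R : realType} {X : metricType R}.
Implicit Types (f g : unitI R -> X).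

Lemma strong_chain_le (e1 e2 : R) f c : e1 <= e2 ->
  strong_chain e1 f c -> strong_chain e2 f c.
Proof.
move=> e12 /strong_chainP[ts [pts lts] ->]; apply/strong_chainP; exists ts => //.
split=> //; apply: sub_path pts => s t /andP[st /asboolP fst].
by apply/andP; split=> //; apply/asboolP => u /fst[]; split; exact: lt_le_trans e12.
Qed.

(** A strong chain for the step [e / 3] along [f] becomes, along any path that is
    [e / 3]-close to [f], a strong chain for the step [e]; the ladder compares the
    two. *)
Lemma strong_chain_near (e : R) f : continuous f -> 0 < e ->
  exists2 d, 0 < d & forall g c c', g zero = f zero -> g one = f one ->
    (forall t, mdist (f t) (g t) < d) ->
    strong_chain e f c -> strong_chain e g c' ->
    open_homotopic e (f zero) c c'.
Proof.
move=> cf e0; have e3 : 0 < e / 3 by rewrite divr_gt0.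
exists (e / 3) => // g c c' g0 g1 fg fc gc'.
have [d /[dup] fd /strong_chainP[ts [pts lts] dE]] := strong_chain_ex cf e3.
have e3e : e / 3 <= e by lra.
apply: rst_trans (strong_chain_unique fc (strong_chain_le e3e fd)) _.
have gts : strong_chain e g (map g ts).
  apply/strong_chainP; exists ts => //; split=> //.
  apply: sub_path pts => s t /andP[st /asboolP fst]; apply/andP; split=> //.
  apply/asboolP => u /fst[fsu ftu]; split.
    have gfs : mdist (g s) (f s) < e / 3 by rewrite metric_sym.
    by have := mdist_tri gfs (mdist_tri fsu (fg u)); lra.
  have gft : mdist (g t) (f t) < e / 3 by rewrite metric_sym.
  by have := mdist_tri gft (mdist_tri ftu (fg u)); lra.
rewrite -g0 in gts *; apply: rst_trans _ (strong_chain_unique gts gc'); rewrite dE.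
have pts' : path (fun s t => mdist (f s) (f t) < e / 3) zero ts.
  by apply: sub_path pts => s t; exact: tame_adjacent.
(* The ladder starts with a repetition of the base point. *)
apply: rst_trans _ (ladder_homotopic pts' fg _); last by rewrite lts.
have pf : path (eps_adjacent e) (f zero) (map f ts).
  by rewrite path_map; apply: sub_path pts' => a b; rewrite /eps_adjacent/=; lra.
rewrite -g0; apply: (@open_homotopic_ins _ _ _ _ [::]); rewrite /= g0 ?pf//.
by rewrite /eps_adjacent mdistxx e0.
Qed.

(** Along a homotopy, the class of the strong chains of the intermediate paths is
    locally constant, hence constant by connectedness of the parameter interval. *)
Lemma strong_chain_homotopic (e : R) x y (f g : {path unitI R from x to y in X})
    c c' : 0 < e -> path_homotopic f g -> strong_chain e f c ->
  strong_chain e g c' -> open_homotopic e x c c'.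
Proof.
move=> e0 [H [cH H0 H1 Hx Hy]] fc gc'.
have cHs s : continuous (fun t => H (t, s)).
  move=> t; apply: (continuous_comp (f := fun t => (t, s))); last exact: cH.
  move=> U [[A B]/= [tA sB] AB]; apply: filterS tA => t' At'.
  by apply: AB; split=> //=; exact: nbhs_singleton.
pose ch s := sval (cid (strong_chain_ex (cHs s) e0)).
have chP s : strong_chain e (fun t => H (t, s)) (ch s) by exact: svalP (cid _).
have ch_near s : \forall s' \near s, open_homotopic e x (ch s) (ch s').
  have [d d0 dP] := strong_chain_near (cHs s) e0.
  apply: filterS (near_uniform s cH d0) => s' Hs'.
  by rewrite -(Hx s); apply: dP => //; rewrite ?Hx ?Hy.
have : open_homotopic e x (ch zero) (ch one).
  apply: (connected_ind (A := setT) (P := fun s => open_homotopic e x (ch zero) (ch s))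
    (a := zero)) => //; [exact: unitI_connected|exact: rst_refl|..].
    move=> s _ hs; apply: filterS (ch_near s) => s' hs' _; exact: rst_trans hs'.
  move=> s _ nhs; apply: filterS (ch_near s) => s' hs' _ h; apply: nhs.
  by apply: rst_trans h _; exact: rst_sym.
have H0f : (fun t => H (t, zero)) = f by apply/funext.
have H1g : (fun t => H (t, one)) = g by apply/funext.
move=> h01; apply: rst_trans (rst_trans _ _ _ _ _ h01 _).
  have fz : f zero = x by rewrite path_zero.
  by rewrite -fz; apply: strong_chain_unique => //; rewrite -H0f.
have gz : g zero = x by rewrite path_zero.
by rewrite -gz; apply: strong_chain_unique => //; rewrite -H1g.
Qed.

End strong_chain_invariance.

(** * Cosets of a normal subgroup *)

Definition normal_subgroup (G : groupType) (N : set G) : Prop :=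
  [/\ N 1%g, forall x y, N x -> N y -> N (x * y)%g, forall x, N x -> N x^-1%g &
      forall x y, N x -> N (y * x * y^-1)%g].

Section normal_cosets.
Local Open Scope group_scope.
Context {G : groupType} {N : set G} (nN : normal_subgroup N).

Lemma coset_classP (x y : G) :
  coset_class N x = coset_class N y <-> N (x^-1 * y).
Proof.
have [N1 NM NV _] := nN; split=> [/eqmodP/asboolP xy|xy].
  have : left_coset N y y by exists 1; rewrite ?mulg1.
  by rewrite -xy => -[n Nn <-]; rewrite mulKg.
apply/eqmodP/asboolP/seteqP; split=> _ [n Nn <-].
  exists (y^-1 * x * n); last by rewrite !mulgA mulgV mul1g.
  by apply: NM => //; have := NV _ xy; rewrite invgM invgK.
by exists (x^-1 * y * n); [exact: NM|rewrite !mulgA mulgV mul1g].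
Qed.

Lemma cosets_mulE (x y : G) :
  cosets_mul (coset_class N x) (coset_class N y) = coset_class N (x * y).
Proof.
have [N1 NM NV NJ] := nN; apply/coset_classP; rewrite invgM.
set x' := repr (coset_class N x); set y' := repr (coset_class N y).
have xN : N (x'^-1 * x) by apply/coset_classP; exact: reprK.
have yN : N (y'^-1 * y) by apply/coset_classP; exact: reprK.
have -> : y'^-1 * x'^-1 * (x * y) =
    (y'^-1 * (x'^-1 * x) * y'^-1^-1) * (y'^-1 * y).
  by rewrite invgK !mulgA mulgK.
by apply: NM => //; exact: NJ.
Qed.

Lemma cosets_invE (x : G) : cosets_inv (coset_class N x) = coset_class N x^-1.
Proof.
have [N1 NM NV NJ] := nN; apply/coset_classP.
set x' := repr _; have xN : N (x'^-1 * x) by apply/coset_classP; exact: reprK.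
rewrite invgK; have := NJ _ x' (NV _ xN).
by rewrite invgM invgK !mulgA mulgK; have := NV _ xN.
Qed.

Lemma coset_ind (P : cosets N -> Prop) :
  (forall x, P (coset_class N x)) -> forall a, P a.
Proof. by move=> Pc a; rewrite -[a]reprK; exact: Pc. Qed.

Lemma cosets_group :
  [/\ associative (@cosets_mul G N), left_id (cosets_one N) (@cosets_mul G N),
      right_id (cosets_one N) (@cosets_mul G N),
      left_inverse (cosets_one N) (@cosets_inv G N) (@cosets_mul G N) &
      right_inverse (cosets_one N) (@cosets_inv G N) (@cosets_mul G N)].
Proof.
split.
- elim/coset_ind => x; elim/coset_ind => y; elim/coset_ind => z.
  by rewrite !cosets_mulE mulgA.
- by elim/coset_ind => x; rewrite cosets_mulE mul1g.
- by elim/coset_ind => x; rewrite cosets_mulE mulg1.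
- by elim/coset_ind => x; rewrite cosets_invE cosets_mulE mulVg.
- by elim/coset_ind => x; rewrite cosets_invE cosets_mulE mulgV.
Qed.

End normal_cosets.

(** * The topological fundamental group *)

Lemma continuous_compose {T U V : topologicalType} (f : T -> U) (g : U -> V) :
  continuous f -> continuous g -> continuous (g \o f).
Proof. by move=> cf cg x; apply: continuous_comp; [exact: cf|exact: cg]. Qed.

Section topological_pi1.
Context {R : realType} {X : metricType R} {p : X}.

Lemma loop_nbhsP (f : loop p) (A : set (loop p)) : nbhs f A <->
  exists2 d, 0 < d &
    forall g : loop p, (forall t, mdist (f t) (g t) < d) -> A g.
Proof.
split.
  rewrite nbhsE => -[_ [[B oB <-] Bf] BA].
  have /uniform_nbhs[E [entE EB]] : nbhs (loop_fun f) B.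
    by apply: open_nbhs_nbhs.
  move: entE; rewrite -(@entourage_ballE R X) => -[d d0 dE]; exists d => // g fg.
  by apply: BA; apply: EB => t _; apply: dE; rewrite /= in_ball; exact: fg.
move=> [d d0 dA]; have : nbhs f (@loop_fun _ _ p @^-1`
    [set h : {uniform unitI R -> X} | forall t, ball (f t) d (h t)]).
  apply: (@initial_continuous _ _ (@loop_fun _ _ p) f); apply/uniform_nbhs.
  exists [set xy | ball xy.1 d xy.2]; split.
    by rewrite -(@entourage_ballE R X); exists d.
  by move=> h /= fh t; exact: fh.
by apply: filterS => g fg; apply: dA => t; have := fg t; rewrite in_ball.
Qed.

Lemma pi1_openE (A : set (pi1 p)) : open A = open (@homotopy_class _ _ p @^-1` A).
Proof. by []. Qed.

Lemma homotopy_class_continuous : continuous (@homotopy_class _ _ p).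
Proof. exact: pi_continuous. Qed.

Lemma pi1_continuous (T : topologicalType) (k : pi1 p -> T) :
  continuous (k \o @homotopy_class _ _ p) -> continuous k.
Proof. by move=> ck; exact/quotient_continuous. Qed.

Lemma loop_concat_continuous (f : loop p) :
  continuous (fun g : loop p => path_concat f g : loop p) /\
  continuous (fun g : loop p => path_concat g f : loop p).
Proof.
by split=> g A /loop_nbhsP[d d0 dA]; apply/loop_nbhsP; exists d => // g' gg';
  apply: dA => t; rewrite /path_concat/= /mk_path/= /concat_fun; case: ifP;
  rewrite ?mdistxx.
Qed.

Lemma loop_reverse_continuous :
  continuous (fun g : loop p => path_reverse g : loop p).
Proof.
move=> g A /loop_nbhsP[d d0 dA]; apply/loop_nbhsP; exists d => // g' gg'.
by apply: dA => t; exact: gg'.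
Qed.

Lemma pi1_mulg_continuous (a : pi1 p) :
  continuous (fun b : pi1 p => a * b)%g /\ continuous (fun b : pi1 p => b * a)%g.
Proof.
move: a; elim/(@pi1_ind R X p) => f; have [cl cr] := loop_concat_continuous f.
split; apply: pi1_continuous.
  rewrite [X in continuous X](_ : _ =
    @homotopy_class _ _ p \o fun g : loop p => path_concat f g : loop p).
    exact: (continuous_compose cl homotopy_class_continuous).
  by apply/funext => g; exact: pi1_mulE.
rewrite [X in continuous X](_ : _ =
  @homotopy_class _ _ p \o fun g : loop p => path_concat g f : loop p).
  exact: (continuous_compose cr homotopy_class_continuous).
by apply/funext => g; exact: pi1_mulE.
Qed.

Lemma pi1_invg_continuous : continuous (fun a : pi1 p => a^-1)%g.
Proof.
apply: pi1_continuous.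
rewrite [X in continuous X](_ : _ =
    @homotopy_class _ _ p \o fun g : loop p => path_reverse g : loop p).
  exact: (continuous_compose loop_reverse_continuous homotopy_class_continuous).
by apply/funext => g; exact: pi1_invE.
Qed.

End topological_pi1.

(** * The homomorphisms to the groups of epsilon-chains *)

Section h_eps.
Context {R : realType} {X : metricType R} {p : X} (e : R) (e0 : 0 < e).
Local Open Scope group_scope.

Lemma strong_chain_loop (f : loop p) c : strong_chain e f c -> eps_loop e p c.
Proof.
move=> fc; have f0 : f zero = p by rewrite path_zero.
have f1 : f one = p by rewrite path_one.
have := strong_chain_path fc; have := strong_chain_last fc.
by rewrite f0 f1 /eps_loop => -> ->; rewrite eqxx.
Qed.

(** The set of values from which [h_eps] selects is a singleton, by homotopy
    invariance of strong chains. *)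
Lemma h_epsE (f : loop p) (c : chain e p) : strong_chain e f (points c) ->
  h_eps e (homotopy_class f) = chain_class c.
Proof.
move=> fc; apply: xget_unique; first by exists c => //; exists f.
move=> _ [d [g gf gd] <-]; apply/open_homotopicP.
apply: strong_chain_homotopic gd fc => //; exact/homotopy_classP.
Qed.

Lemma h_eps_ex (f : loop p) : exists2 c : chain e p,
  strong_chain e f (points c) & h_eps e (homotopy_class f) = chain_class c.
Proof.
have [c fc] := strong_chain_ex (@cts_fun _ _ f) e0.
pose d := mk_chain (strong_chain_loop fc).
by exists d => //; exact: h_epsE.
Qed.

Lemma h_epsM (a b : pi1 p) : h_eps e (a * b) = h_eps e a * h_eps e b.
Proof.
move: a b; elim/(@pi1_ind R X p) => f; elim/(@pi1_ind R X p) => g.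
have [c fc ->] := h_eps_ex f; have [d gd ->] := h_eps_ex g.
rewrite [LHS](_ : _ = h_eps e (homotopy_class (path_concat f g))); last first.
  by congr h_eps; exact: pi1_mulE.
rewrite [RHS](pi_eps_mulE c d); apply: h_epsE; apply: strong_chain_concat => //.
exact: path_concat_subproof.
Qed.

Lemma h_eps1 : h_eps e (1 : pi1 p) = 1.
Proof.
by apply: (mulgI (h_eps e (1 : pi1 p))); rewrite -h_epsM !mulg1.
Qed.

Lemma h_epsV (a : pi1 p) : h_eps e a^-1 = (h_eps e a)^-1.
Proof.
by apply: (mulgI (h_eps e a)); rewrite -h_epsM !mulgV h_eps1.
Qed.

Lemma K_eps_normal : normal_subgroup (@K_eps _ _ e p).
Proof.
split=> [|a b Ka Kb|a Ka|a b Ka]; rewrite /K_eps/=; first exact: h_eps1.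
- by rewrite h_epsM Ka Kb mulg1.
- by rewrite h_epsV Ka invg1.
- by rewrite !h_epsM h_epsV Ka mulg1 mulgV.
Qed.

(** Uniformly close loops have homotopic strong chains, so that [h_eps] is locally
    constant. *)
Lemma h_eps_open (A : set (pi_eps e p)) : open (@h_eps _ _ e p @^-1` A).
Proof.
rewrite pi1_openE openE => f /= Af; apply/loop_nbhsP.
have [d d0 dP] := strong_chain_near (@cts_fun _ _ f) e0.
exists d => // g fg; rewrite /preimage/=.
suff <- : h_eps e (homotopy_class f) = h_eps e (homotopy_class g) by [].
have [c fc ->] := h_eps_ex f; have [c' gc' ->] := h_eps_ex g.
apply/open_homotopicP; have f0 : f zero = p by rewrite path_zero.
have f1 : f one = p by rewrite path_one.
have g0 : g zero = p by rewrite path_zero.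
have g1 : g one = p by rewrite path_one.
by rewrite -{1}f0; apply: (dP g) => //;
  [exact: etrans g0 (esym f0)|exact: etrans g1 (esym f1)].
Qed.

End h_eps.

Section pi1_bar.
Context {R : realType} {X : metricType R} {p : X}.
Local Open Scope group_scope.

Lemma pi_cl_normal : normal_subgroup (@pi_cl _ _ p).
Proof.
split=> [e|a b Na Nb e|a Na e|a b Na e] /= e0;
  have [N1 NM NV NJ] := @K_eps_normal _ _ p e e0.
- exact: N1.
- by apply: NM; [exact: Na|exact: Nb].
- by apply: NV; exact: Na.
- by apply: NJ; exact: Na.
Qed.

Lemma pi1_bar_openE (A : set (pi1_bar p)) :
  open A = open (@coset_class _ (@pi_cl _ _ p) @^-1` A).
Proof. by []. Qed.

Lemma pi1_bar_continuous (T : topologicalType) (k : pi1_bar p -> T) :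
  continuous (k \o @coset_class _ (@pi_cl _ _ p)) -> continuous k.
Proof. by move=> ck; exact/quotient_continuous. Qed.

Lemma coset_class_continuous :
  continuous (@coset_class _ (@pi_cl _ _ p) : pi1 p -> pi1_bar p).
Proof. exact: pi_continuous. Qed.

Lemma pi1_bar_quasitopological :
  quasitopological_group (T := pi1_bar p) (cosets_one _) (@cosets_inv _ _)
    (@cosets_mul _ _).
Proof.
split; first exact: (cosets_group pi_cl_normal).
split=> [|a|b]; apply: pi1_bar_continuous.
- rewrite [X in continuous X](_ : _ =
    (@coset_class _ (@pi_cl _ _ p) : _ -> pi1_bar p) \o (fun x : pi1 p => x^-1)).
    exact: (continuous_compose pi1_invg_continuous coset_class_continuous).
  by apply/funext => x; exact: (cosets_invE pi_cl_normal).
- move: a; elim/(@coset_ind _ (@pi_cl _ _ p)) => a.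
  rewrite [X in continuous X](_ : _ =
    (@coset_class _ (@pi_cl _ _ p) : _ -> pi1_bar p) \o (fun x : pi1 p => a * x)).
    exact: (continuous_compose (pi1_mulg_continuous a).1 coset_class_continuous).
  by apply/funext => x; exact: (cosets_mulE pi_cl_normal).
- move: b; elim/(@coset_ind _ (@pi_cl _ _ p)) => b.
  rewrite [X in continuous X](_ : _ =
    (@coset_class _ (@pi_cl _ _ p) : _ -> pi1_bar p) \o (fun x : pi1 p => x * b)).
    exact: (continuous_compose (pi1_mulg_continuous b).2 coset_class_continuous).
  by apply/funext => x; exact: (cosets_mulE pi_cl_normal).
Qed.

(** Distinct cosets of [pi_cl] are already distinguished by some [h_eps], and
    [h_eps] is constant on cosets of [pi_cl] and locally constant. *)
Lemma pi1_bar_accessible : accessible_space (pi1_bar p).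
Proof.
elim/(@coset_ind _ (@pi_cl _ _ p)) => a; elim/(@coset_ind _ (@pi_cl _ _ p)) => b ab.
have [e e0 Kab] : exists2 e : R, 0 < e & ~ @K_eps _ _ e p (a^-1 * b).
  apply: contrapT => K; move/eqP: ab; apply; apply/coset_classP.
    exact: pi_cl_normal.
  by move=> e /= e0; apply: contrapT => Ke; apply: K; exists e.
have hE c : h_eps e (repr (coset_class (@pi_cl _ _ p) c)) = h_eps e c.
  set c' := repr _; have /(_ _ e0) : pi_cl (c'^-1 * c).
    by apply/(coset_classP pi_cl_normal); exact: reprK.
  rewrite /= /K_eps/= h_epsM// h_epsV// => cc'.
  by apply/esym; rewrite -[LHS](mulVKg (h_eps e c')) cc' mulg1.
exists [set c : pi1_bar p | h_eps e (repr c) = h_eps e a]; split.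
- rewrite pi1_bar_openE [X in open X](_ : _ = @h_eps _ _ e p @^-1` [set h_eps e a]).
    exact: h_eps_open.
  by apply/seteqP; split=> c /=; rewrite hE.
- by rewrite inE/= hE.
- rewrite inE/= hE => ba; apply: Kab.
  by rewrite /K_eps/= h_epsM// h_epsV// ba mulVg.
Qed.

Lemma discrete_pi_cl_open : discrete_space (pi1_bar p) -> open (@pi_cl _ _ p).
Proof.
move=> /(_ [set coset_class (@pi_cl _ _ p) 1 : pi1_bar p]); rewrite pi1_bar_openE.
congr open; apply/seteqP; split=> a /=.
  by move=> /esym/(coset_classP pi_cl_normal); rewrite invg1 mul1g.
by move=> Na; apply/esym/(coset_classP pi_cl_normal); rewrite invg1 mul1g.
Qed.

(** The cosets of [pi_cl] are then unions of fibres of the locally constant map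
    [h_eps]. *)
Lemma K_eps_discrete (e : R) : 0 < e ->
  @K_eps _ _ e p `<=` @pi_cl _ _ p -> discrete_space (pi1_bar p).
Proof.
move=> e0 Ke A; rewrite pi1_bar_openE openE => a /= Aa.
have : nbhs a (@h_eps _ _ e p @^-1` [set h_eps e a]).
  by apply: open_nbhs_nbhs; split=> //; exact: h_eps_open.
apply: filterS => b /= ba.
suff <- : coset_class (@pi_cl _ _ p) a = coset_class (@pi_cl _ _ p) b by [].
by apply/(coset_classP pi_cl_normal)/Ke; rewrite /K_eps/= h_epsM// h_epsV// ba mulVg.
Qed.

End pi1_bar.

(** * Covers and their sections *)

Section sections.
Context {Y X : topologicalType} (f : Y -> X).

(** [S y] is the section over [U] whose image is the sheet through [y]. The
    identity [S (S y u) v = S y v] says that the sheets through two points of one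
    sheet are the same. This form of even covering is the one that can be
    constructed and transported directly, without a family of sheets. *)
Definition local_sections (U : set X) (S : Y -> X -> Y) : Prop :=
  forall y, U (f y) -> [/\ open (S y @` U), S y (f y) = y,
    forall u, U u -> {for u, continuous (S y)} &
    forall u, U u -> f (S y u) = u /\ forall v, U v -> S (S y u) v = S y v].

Lemma evenly_covered_sections (U : set X) : open U -> evenly_covered f U ->
  exists S, local_sections U S.
Proof.
move=> oU [F [oF tF fF homF]].
have /choice[P PP] : forall y, exists P : set Y * (X -> Y), U (f y) ->
    [/\ F P.1, P.1 y, {within U, continuous P.2} & {in P.1, cancel f P.2}].
  move=> y; have [Uy|nUy] := pselect (U (f y)); last by exists (set0, cst y).
  have : (f @^-1` U) y by []; rewrite fF => -[V FV Vy].
  by have [_ _ [g [gc gK]]] := homF V FV; exists (V, g).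
have PV y u : U (f y) -> U u -> (P y).1 ((P y).2 u) /\ f ((P y).2 u) = u.
  move=> Uy; have [FV _ _ gK] := PP y Uy; have [fV _ _] := homF _ FV.
  by rewrite -fV => -[v Vv <-]; rewrite gK// inE.
exists (fun y => (P y).2) => y Uy; have [FV Vy gc gK] := PP y Uy.
split.
- suff -> : (P y).2 @` U = (P y).1 by exact: oF.
  apply/seteqP; split=> [_ [u Uu <-]|v Vv]; first by have [] := PV y u Uy Uu.
  have [fV _ _] := homF _ FV.
  by exists (f v); [rewrite -fV; exists v|rewrite gK// inE].
- by rewrite gK// inE.
- move=> u Uu; have : {in U, continuous (P y).2}.
    by rewrite -(continuous_open_subspace _ oU).
  by apply; rewrite inE.
- move=> u Uu; have [Vgu fgu] := PV y u Uy Uu; split=> // v Uv.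
  set y' := (P y).2 u in Vgu fgu *.
  have Uy' : U (f y') by rewrite fgu.
  have [FV' V'y _ gK'] := PP y' Uy'; have [Vv fv] := PV y v Uy Uv.
  have V'V : (P y').1 = (P y).1 by apply: tF => //; exists y'.
  by rewrite -{1}fv gK'// inE V'V.
Qed.

Lemma sections_evenly_covered (U : set X) S : open U -> continuous f ->
  local_sections U S -> evenly_covered f U.
Proof.
move=> oU cf SP; exists [set V | exists2 y, U (f y) & V = S y @` U]; split.
- by move=> _ [y Uy ->]; have [] := SP y Uy.
- move=> _ _ [y Uy ->] [y' Uy' ->] [w [/= [u Uu uw] [u' Uu' uw']]].
  have [_ _ _ /(_ u Uu)[fu Su]] := SP y Uy.
  have [_ _ _ /(_ u' Uu')[fu' Su']] := SP y' Uy'.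
  by apply/seteqP; split=> _ [v Uv <-]; exists v => //;
    [rewrite -Su'// -Su// uw uw'|rewrite -Su'// -Su// uw uw'].
- apply/seteqP; split=> [y Uy|y [_ [z Uz ->] [u Uu <-]]].
    have [_ Sy _ _] := SP y Uy; exists (S y @` U); first by exists y.
    by exists (f y).
  by have [_ _ _ /(_ u Uu)[fu _]] := SP z Uz; rewrite /preimage/= fu.
- move=> _ [y Uy ->]; have [_ Sy cS SS] := SP y Uy; split.
  + apply/seteqP; split=> [_ [_ [u Uu <-] <-]|u Uu].
      by have [->] := SS u Uu.
    by exists (S y u); [exists u|have [->] := SS u Uu].
  + exact: continuous_subspaceT.
  + exists (S y); split.
      rewrite (continuous_open_subspace _ oU) => u; rewrite inE => Uu; exact: cS.
    by move=> z; rewrite inE => -[u Uu <-]; have [->] := SS u Uu.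
Qed.

Lemma local_sectionsS (U V : set X) S : open V -> continuous f -> V `<=` U ->
  local_sections U S -> local_sections V S.
Proof.
move=> oV cf VU SP y Vy; have [oS Sy cS SS] := SP y (VU _ Vy); split=> //.
- suff -> : S y @` V = S y @` U `&` f @^-1` V.
    by apply: openI => //; move/continuousP: cf; apply.
  apply/seteqP; split=> [_ [v Vv <-]|_ [[u Uu <-]]].
    split; first by exists v => //; exact: VU.
    by have [fv _] := SS v (VU _ Vv); rewrite /preimage/= fv.
  by have [fu _] := SS u Uu; rewrite /preimage/= fu => Vu; exists u.
- by move=> u /VU; exact: cS.
- by move=> u /VU Uu; have [fu Su] := SS u Uu; split=> // v /VU; exact: Su.
Qed.

Lemma cover_sections x : is_cover f ->
  exists U S, [/\ open U, U x & local_sections U S].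
Proof.
move=> [_ _ _ /(_ x)[U [oU Ux eU]]].
by have [S SP] := evenly_covered_sections oU eU; exists U, S.
Qed.

(** Two lifts of one map stay in one sheet as long as they agree, and in disjoint
    sheets as long as they differ, so that they agree on an open and closed set. *)
Lemma lift_unique {T : topologicalType} (A : set T) (u v : T -> Y) a :
  is_cover f -> connected A ->
  (forall b, A b -> {for b, continuous u}) ->
  (forall b, A b -> {for b, continuous v}) ->
  (forall b, A b -> f (u b) = f (v b)) ->
  A a -> u a = v a -> forall b, A b -> u b = v b.
Proof.
move=> covf cA cu cv fuv Aa uva.
apply: (connected_ind (P := fun b => u b = v b) cA Aa uva) => b Ab uvb.
  have [U [S [oU Ub SP]]] := cover_sections (f (u b)) covf.
  have [oS Sb cS SS] := SP _ Ub.
  have uV : nbhs (u b) (S (u b) @` U).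
    by apply: open_nbhs_nbhs; split=> //; exists (f (u b)).
  have vV : nbhs (v b) (S (u b) @` U) by rewrite -uvb.
  near=> c => Ac.
  have [w Uw wu] : (S (u b) @` U) (u c) by near: c; exact: cu uV.
  have [w' Uw' w'v] : (S (u b) @` U) (v c) by near: c; exact: cv vV.
  have := fuv c Ac; rewrite -wu -w'v; have [-> _] := SS _ Uw.
  by have [-> _] := SS _ Uw'; move=> ->.
have [U [S [oU Ub SP]]] := cover_sections (f (u b)) covf.
have Ub' : U (f (v b)) by rewrite -fuv.
have [oS Sb cS SS] := SP _ Ub; have [oS' Sb' cS' SS'] := SP _ Ub'.
have uV : nbhs (u b) (S (u b) @` U).
  by apply: open_nbhs_nbhs; split=> //; exists (f (u b)).
have vV : nbhs (v b) (S (v b) @` U).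
  by apply: open_nbhs_nbhs; split=> //; exists (f (v b)).
near=> c => Ac uvc; apply: uvb.
have [w Uw wu] : (S (u b) @` U) (u c) by near: c; exact: cu uV.
have [w' Uw' w'v] : (S (v b) @` U) (v c) by near: c; exact: cv vV.
rewrite -Sb -(SS _ Uw).2// wu uvc -w'v (SS' _ Uw').2 ?Sb'//.
by rewrite fuv.
Unshelve. all: end_near. Qed.

End sections.

(** * Geodesic spaces *)

Section geodesic.
Context {R : realType} {X : metricType R}.
Implicit Types x y : X.

(** A point of a geodesic is no farther from its origin than its end is, so that
    geodesics join the centre of a ball to its points inside the ball. *)
Lemma geodesic_path x y : geodesic_space X ->
  exists s : {path unitI R from x to y in X},
    forall t, mdist x (s t) <= mdist x y.
Proof.
move=> /(_ x y)[s sl]; exists s => t.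
have [->|t0] := eqVneq t zero; first by rewrite path_zero mdistxx mdist_ge0.
have [->|t1] := eqVneq t one; first by rewrite path_one.
have /andP[t0' t1'] := unit_valP t.
have {}t0 : 0 < unit_val t.
  rewrite lt_neqAle t0' andbT; apply: contraNneq t0 => t0.
  by apply/eqP/unit_val_inj; rewrite unit_val0.
have {}t1 : unit_val t < 1.
  rewrite lt_neqAle t1' andbT; apply: contraNneq t1 => t1.
  by apply/eqP/unit_val_inj; rewrite unit_val1.
have : ((mdist x (s t) + mdist (s t) y)%:E <= path_length s)%E.
  (* the partition of the unit interval at [t] *)
  apply: ereal_sup_ubound; exists [:: t; one].
    by rewrite /= /itv_partition/= unit_val1 t0 t1 eqxx.
  by rewrite !big_ord_recl big_ord0 /= addr0 path_zero path_one.
rewrite sl lee_fin; have := mdist_ge0 (s t) y; lra.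
Qed.

Lemma ball_connected x (r : R) : geodesic_space X -> connected (ball x r).
Proof.
move=> gX; have [r0|r0] := ltP 0 r; last first.
  suff -> : ball x r = set0 by exact: connected0.
  apply/seteqP; split=> // y; rewrite in_ball => /lt_le_trans/(_ r0).
  by rewrite ltNge mdist_ge0.
pose s y := sval (cid (geodesic_path x y gX)).
have sP y : forall t, mdist x (s y t) <= mdist x y.
  by rewrite /s; case: cid.
have -> : ball x r = \bigcup_(y in ball x r) range (s y).
  apply/seteqP; split=> [y ry|_ [y ry [t _ <-]]].
    by exists y => //; exists one => //; rewrite path_one.
  by move: ry; rewrite !in_ball; exact: le_lt_trans.
apply: bigcup_connected.
  by exists x => y _; exists zero => //; rewrite path_zero.
move=> y _; apply: connected_continuous_connected; first exact: unitI_connected.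
by apply: continuous_subspaceT; exact: cts_fun.
Qed.

End geodesic.

(** * Transport in covers of compact geodesic spaces *)

Section transport.
Context {R : realType} {X : metricType R} {Y : topologicalType} (f : Y -> X).

(** [T y u] is the point over [u] of the sheet through [y], for [u] close to
    [f y]; so [foldl T y c] is the end of the lift from [y] of the chain [c]. The
    last condition is the invariance under the insertion of a point. *)
Definition transport (e : R) (T : Y -> X -> Y) : Prop := forall y,
  [/\ T y (f y) = y,
      forall u, mdist (f y) u < e -> f (T y u) = u /\ {for u, continuous (T y)} &
      forall u v, mdist (f y) u < e -> mdist (f y) v < e -> mdist u v < e ->
        T (T y u) v = T y v].

(** If all balls of radius [r] are evenly covered, moving [y] to [u] and then to
    [v] involves the sections over the balls at [f y] and at [u]. On the ball of
    radius [r / 2] at [u], which is connected, both sections are defined, and they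
    agree at [u]; so they agree at [v]. *)
Lemma cover_transport : compact [set: X] -> geodesic_space X -> is_cover f ->
  exists2 e, 0 < e & exists T, transport e T.
Proof.
move=> cX gX covf; have [_ cf _ _] := covf.
pose Q A := exists U S, [/\ open U, A `<=` U & local_sections f U S].
have [|x|r r0 rP] := @lebesgue_number _ _ Q cX.
- by move=> A B AB [U [S [oU BU SP]]]; exists U, S; split=> //; exact: subset_trans BU.
- have [U [S [oU Ux SP]]] := cover_sections x covf.
  have /nbhs_metricP[r r0 rU] : nbhs x U by exact: open_nbhs_nbhs.
  by exists r => //; exists U, S; split=> // y; rewrite in_ball => /rU.
have /choice[S SP] : forall x, exists S, local_sections f (ball x r) S.
  move=> x; have [U [S [oU BU SP]]] := rP x; exists S.
  by apply: local_sectionsS SP => //; exact: metric_ball_open.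
have r2 : 0 < r / 2 by exact: divr_gt0.
have rr : r / 2 < r by lra.
have rx (x : X) : ball x r x by rewrite in_ball mdistxx.
exists (r / 2) => //; exists (fun y => S (f y) y) => y.
have [oS Sy cS SS] := SP (f y) y (rx _); split=> // [u yu|u v yu yv uv].
  have ru : ball (f y) r u by rewrite in_ball (lt_trans yu).
  by split; [exact: (SS _ ru).1|exact: cS].
have ru : ball (f y) r u by rewrite in_ball (lt_trans yu).
have fu := (SS _ ru).1; rewrite fu.
set y' := S (f y) y u in fu *.
have [|oS' Sy' cS' SS'] := SP u y'; first by rewrite fu.
apply: (lift_unique (A := ball u (r / 2)) (a := u) covf).
- exact: ball_connected.
- by move=> w; rewrite in_ball => uw; apply: cS'; rewrite in_ball (lt_trans uw).
- move=> w; rewrite in_ball => uw; apply: cS.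
  by rewrite in_ball (splitr r); exact: mdist_tri yu uw.
- move=> w; rewrite in_ball => uw.
  rewrite (SS' w _).1 ?(SS w _).1//.
    by rewrite in_ball (splitr r); exact: mdist_tri yu uw.
  by rewrite in_ball (lt_trans uw).
- by rewrite in_ball mdistxx.
- by move: Sy'; rewrite fu.
- by rewrite in_ball.
Qed.

Lemma transport_path (e : R) T y c : transport e T ->
  path (eps_adjacent e) (f y) c -> f (foldl T y c) = last (f y) c.
Proof.
move=> TP; elim: c y => //= x c IH y /andP[yx pc].
by have [_ /(_ x yx)[fT _] _] := TP y; rewrite IH fT.
Qed.

Lemma transport_homotopic (e : R) T y c c' : transport e T ->
  open_homotopic e (f y) c c' -> foldl T y c = foldl T y c'.
Proof.
move=> TP; elim=> [{}c {}c'|//|? ? _ ->//|? ? ? _ -> _ ->//].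
move=> [pc pc' lcc' [s1 [x [s2 [cE c'E]]]]]; move: pc pc' lcc'.
rewrite {}cE {}c'E !cat_path !foldl_cat !last_cat.
move=> /andP[p1 p2] /andP[_ /= /andP[p3 p4]].
rewrite -!(transport_path TP p1) in p2 p3 *.
set z := foldl T y s1 in p2 p3 *; have [Tz _ TT] := TP z.
case: s2 p2 p4 => [_ _ /= <-|v s2 /= /andP[p2 _] /andP[p4 _] _].
  by rewrite Tz.
by rewrite TT.
Qed.

End transport.

(** * Factors of covers *)

(** Over a ball that is evenly covered by both [f] and [g], the uniqueness of lifts
    shows that [h] maps the sheets of [f] onto the sheets of [g]. Hence the sheets
    of [g] are evenly covered by [h]; each of them lies in the image of [h] or is
    disjoint from it, and the connectedness of [Z] makes [h] surjective. *)
Lemma cover_factor {R : realType} {X : metricType R} {Y Z : topologicalType}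
    (f : Y -> X) (g : Z -> X) (h : Y -> Z) :
  geodesic_space X -> is_cover f -> is_cover g -> continuous h -> g \o h = f ->
  is_cover h.
Proof.
move=> gX covf covg ch ghf.
have [cY cf rf _] := covf; have [cZ cg rg _] := covg.
have ghE y : g (h y) = f y by rewrite -ghf.
have loc x : exists r Sf Sg, [/\ 0 < r, local_sections f (ball x r) Sf &
    local_sections g (ball x r) Sg].
  have [U [Sf [oU Ux SfP]]] := cover_sections x covf.
  have [V [Sg [oV Vx SgP]]] := cover_sections x covg.
  have /nbhs_metricP[r r0 rUV] : nbhs x (U `&` V).
    by apply: open_nbhs_nbhs; split=> //; exact: openI.
  exists r, Sf, Sg; split=> //.
    apply: local_sectionsS SfP => //; first exact: metric_ball_open.
    by move=> y; rewrite in_ball => /rUV[].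
  apply: local_sectionsS SgP => //; first exact: metric_ball_open.
  by move=> y; rewrite in_ball => /rUV[].
(* [h] commutes with the sections because a section and the image of a section
   are lifts of the identity on a connected ball. *)
have hS x r Sf Sg : local_sections f (ball x r) Sf ->
    local_sections g (ball x r) Sg -> forall y u, ball x r (f y) -> ball x r u ->
    h (Sf y u) = Sg (h y) u.
  move=> SfP SgP y u ry ru.
  have [_ Sfy cSf SSf] := SfP y ry.
  have [|_ Sgy cSg SSg] := SgP (h y); first by rewrite ghE.
  apply: (lift_unique (A := ball x r) (a := f y) (u := h \o Sf y) covg) => //.
  - exact: ball_connected.
  - by move=> w rw; apply: continuous_comp; [exact: cSf|exact: ch].
  - by move=> w rw /=; rewrite ghE (SSf _ rw).1 (SSg _ rw).1.
  - by rewrite /= Sfy -ghE Sgy.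
have hW x r Sf Sg z y : local_sections f (ball x r) Sf ->
    local_sections g (ball x r) Sg -> ball x r (g z) -> (Sg z @` ball x r) (h y) ->
    forall u, ball x r u -> h (Sf y u) = Sg z u.
  move=> SfP SgP rz [w rw wh] u ru.
  have [_ _ _ SSg] := SgP z rz.
  have fyw : f y = w by rewrite -ghE -wh (SSg _ rw).1.
  by rewrite (hS _ _ _ _ SfP SgP) ?fyw// -wh (SSg _ rw).2.
split=> //.
- apply/seteqP; split=> // z _.
  have [y0 _ fy0] : range f (g z) by rewrite rf.
  apply: (connected_ind (A := setT) (a := h y0) (P := fun z => range h z) cZ) => //.
  - move=> {z fy0}z _ [y _ yz].
    have [r [Sf [Sg [r0 SfP SgP]]]] := loc (g z).
    have rz : ball (g z) r (g z) by rewrite in_ball mdistxx.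
    have [oSg Sgz _ SSg] := SgP z rz.
    have : nbhs z (Sg z @` ball (g z) r).
      by apply: open_nbhs_nbhs; split=> //; exists (g z).
    apply: filterS => _ [w rw <-] _; exists (Sf y w) => //.
    by apply: (hW _ _ _ _ _ _ SfP SgP) => //; exists (g z); rewrite // yz.
  - move=> {z fy0}z _ nz.
    have [r [Sf [Sg [r0 SfP SgP]]]] := loc (g z).
    have rz : ball (g z) r (g z) by rewrite in_ball mdistxx.
    have [oSg Sgz _ SSg] := SgP z rz.
    have : nbhs z (Sg z @` ball (g z) r).
      by apply: open_nbhs_nbhs; split=> //; exists (g z).
    apply: filterS => _ [w rw <-] _ [y _ yw]; apply: nz.
    exists (Sf y (g z)) => //; rewrite (hW _ _ _ _ _ _ SfP SgP rz _ _ rz) ?Sgz//.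
    by exists w.
- move=> z; have [r [Sf [Sg [r0 SfP SgP]]]] := loc (g z).
  have rz : ball (g z) r (g z) by rewrite in_ball mdistxx.
  have [oSg Sgz cSg SSg] := SgP z rz.
  exists (Sg z @` ball (g z) r); split=> //; first by exists (g z).
  apply: (sections_evenly_covered (S := fun y w => Sf y (g w))) => // y Wy.
  have ry : ball (g z) r (f y).
    by case: Wy => w rw wy; rewrite -ghE -wy (SSg _ rw).1.
  have [oSf Sfy cSf SSf] := SfP y ry; split.
  + suff -> : (fun w => Sf y (g w)) @` (Sg z @` ball (g z) r) =
        Sf y @` ball (g z) r by [].
    apply/seteqP; split=> [_ [_ [w rw <-] <-]|_ [w rw <-]].
      by rewrite (SSg _ rw).1; exists w.
    by exists (Sg z w); [exists w|rewrite (SSg _ rw).1].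
  + by rewrite ghE.
  + move=> _ [w rw <-]; apply: continuous_comp; first exact: cg.
    by apply: cSf; rewrite (SSg _ rw).1.
  + move=> _ [w rw <-]; rewrite (SSg _ rw).1; split.
      exact: (hW _ _ _ _ _ _ SfP SgP).
    by move=> _ [w' rw' <-]; rewrite (SSg _ rw').1 (SSf _ rw).2.
Qed.

(** * Calculus of paths *)

(** The next two instances allow rewriting with homotopies of paths. *)
#[local] Instance path_homotopic_equivalence {R : realType} {X : topologicalType}
  (x y : X) : RelationClasses.Equivalence (@path_homotopic R X x y).
Proof.
split.
- exact: path_homotopic_refl.
- exact: path_homotopic_sym.
- exact: path_homotopic_trans.
Qed.

#[local] Instance path_concat_proper {R : realType} {X : topologicalType}
  (x y z : X) : Morphisms.Proper (Morphisms.respectful (@path_homotopic R X x y)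
    (Morphisms.respectful (@path_homotopic R X y z) (@path_homotopic R X x z)))
    (@path_concat R X x y z).
Proof. by move=> f f' ff' g g'; exact: path_concat_homotopic. Qed.

#[local] Hint Resolve path_homotopic_refl : core.

Section path_calculus.
Context {R : realType} {X : topologicalType}.
Implicit Types x y z : X.

Lemma path_concatK x y z (f : {path unitI R from x to y in X})
  (g : {path unitI R from y to z in X}) :
  path_homotopic (path_concat (path_concat f g) (path_reverse g)) f.
Proof. by rewrite -path_concatA path_concatpN path_concatp1. Qed.

Lemma path_concatVK x y z (f : {path unitI R from x to y in X})
  (g : {path unitI R from z to y in X}) :
  path_homotopic (path_concat (path_concat f (path_reverse g)) g) f.
Proof. by rewrite -path_concatA path_concatNp path_concatp1. Qed.

Lemma concat_fun_in (A : set X) (f g : unitI R -> X) :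
  (forall t, A (f t)) -> (forall t, A (g t)) -> forall t, A (concat_fun f g t).
Proof. by move=> Af Ag t; rewrite /concat_fun; case: ifP. Qed.

Lemma segment_continuous (f : unitI R -> X) (a b : R) : continuous f ->
  continuous (fun u => f (clamp (b * unit_val u + a))).
Proof.
move=> cf; apply: (continuous_compose (f := fun u => clamp (b * unit_val u + a))
  (g := f)); last exact: cf.
apply: (clamp_comp_continuous (phi := fun u => b * unit_val u + a)).
exact/affine_continuous/unit_val_continuous.
Qed.

(** The part of [f] before [t], and below the part of [f] from [s] to [t], which
    is traversed backwards if [t] precedes [s]. *)
Definition initial_fun (f : unitI R -> X) (t u : unitI R) : X :=
  f (clamp (unit_val t * unit_val u + 0)).

Definition restr_fun (f : unitI R -> X) (s t u : unitI R) : X :=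
  f (clamp ((unit_val t - unit_val s) * unit_val u + unit_val s)).

Lemma initial_fun0 x y (f : {path unitI R from x to y in X}) t :
  initial_fun f t zero = x.
Proof. by rewrite /initial_fun unit_val0 mulr0 addr0 path_zero. Qed.

Lemma initial_fun1 (f : unitI R -> X) t : initial_fun f t one = f t.
Proof. by rewrite /initial_fun unit_val1 mulr1 addr0 clampK. Qed.

Lemma restr_fun0 (f : unitI R -> X) s t : restr_fun f s t zero = f s.
Proof. by rewrite /restr_fun unit_val0 mulr0 add0r clampK. Qed.

Lemma restr_fun1 (f : unitI R -> X) s t : restr_fun f s t one = f t.
Proof. by rewrite /restr_fun unit_val1 mulr1 subrK clampK. Qed.

Definition initial_path x y (f : {path unitI R from x to y in X}) (t : unitI R) :
    {path unitI R from x to f t in X} :=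
  mk_path (@segment_continuous f 0 (unit_val t) (@cts_fun _ _ f)) (initial_fun0 f t)
    (initial_fun1 f t).

Definition restr_path x y (f : {path unitI R from x to y in X}) (s t : unitI R) :
    {path unitI R from f s to f t in X} :=
  mk_path (@segment_continuous f (unit_val s) (unit_val t - unit_val s)
    (@cts_fun _ _ f))
    (restr_fun0 f s t) (restr_fun1 f s t).

Lemma initial_restr_path x y (f : {path unitI R from x to y in X}) s t :
  path_homotopic (initial_path f t)
    (path_concat (initial_path f s) (restr_path f s t)).
Proof.
apply: (@path_homotopic_reparam _ _ _ _ _ _ f
  (fun u => unit_val t * unit_val u + 0)
  (* affine on each half of the interval, with value [s] in the middle *)
  (fun u => (unit_val s * Num.min (2 * unit_val u + 0) 1 + 0) +
    ((unit_val t - unit_val s) * Num.max (2 * unit_val u + -1) 0 + 0))).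
- exact: cts_fun.
- exact/affine_continuous/unit_val_continuous.
- have c2 a : continuous (fun u : unitI R => 2 * unit_val u + a).
    exact/affine_continuous/unit_val_continuous.
  have cmin : continuous (fun u : unitI R => Num.min (2 * unit_val u + 0) 1).
    move=> u; apply: (@continuous_min R (unitI R)
      (fun u => 2 * unit_val u + 0) (cst 1)).
      exact: (c2 0 u).
    exact: cst_continuous.
  have cmax : continuous (fun u : unitI R => Num.max (2 * unit_val u + -1) 0).
    move=> u; apply: (@continuous_max R (unitI R)
      (fun u => 2 * unit_val u + -1) (cst 0)).
      exact: (c2 (-1) u).
    exact: cst_continuous.
  move=> u; apply: cvgD; first exact: nbhs_filter.
    exact: (affine_continuous (a := unit_val s) (b := 0) cmin).
  exact: (affine_continuous (a := unit_val t - unit_val s) (b := 0) cmax).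
- by rewrite unit_val0 min_l ?max_r; lra.
- by rewrite unit_val1 min_r ?max_l; lra.
- by [].
- move=> u; rewrite [LHS](_ : _ =
    concat_fun (initial_fun f s) (restr_fun f s t) u)//.
  have /andP[u0 u1] := unit_valP u; rewrite /concat_fun.
  have [u2|u2] := leP (unit_val u) 2^-1.
    rewrite /initial_fun clampE; last by lra.
    by rewrite min_l ?max_r ?mulr0; [congr (f (clamp _)); lra|lra..].
  rewrite /restr_fun clampE; last by lra.
  by rewrite min_r ?max_l; [congr (f (clamp _)); lra|lra..].
Qed.

End path_calculus.

(** * The cover defined by an open normal subgroup *)

Section small_loops.
Context {R : realType} {X : metricType R} {p : X}.

Record open_normal_subgroup := OpenNormalSubgroup {
  subgroup_set : set (pi1 p);
  subgroup_normal : normal_subgroup subgroup_set;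
  subgroup_open : open subgroup_set }.

Context (N : open_normal_subgroup).
Implicit Types x y z : X.

(** The paths [f] and [g] are equivalent when the loop that follows [f] and returns
    along [g] is in [N]. This form avoids the reversal of [g], which makes it
    obviously stable under concatenation on the right. *)
Definition sim x (f g : {path unitI R from p to x in X}) : Prop :=
  exists2 l : loop p, subgroup_set N (homotopy_class l) &
    path_homotopic f (path_concat l g).

Lemma subgroup1 :
  subgroup_set N (homotopy_class (cst p : {path unitI R from p to p in X})).
Proof. by case: (subgroup_normal N). Qed.

Lemma subgroupM (l m : loop p) :
  subgroup_set N (homotopy_class l) -> subgroup_set N (homotopy_class m) ->
  subgroup_set N (homotopy_class (path_concat l m)).
Proof.
have [_ NM _ _] := subgroup_normal N => Nl Nm.
by have := NM _ _ Nl Nm; rewrite -pi1_mulE.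
Qed.

Lemma subgroupV (l : loop p) : subgroup_set N (homotopy_class l) ->
  subgroup_set N (homotopy_class (path_reverse l)).
Proof.
have [_ _ NV _] := subgroup_normal N => Nl.
by have := NV _ Nl; rewrite -pi1_invE.
Qed.

Lemma sim_homotopic x (f g : {path unitI R from p to x in X}) :
  path_homotopic f g -> sim f g.
Proof.
by move=> fg; exists (cst p); [exact: subgroup1|rewrite path_concat1p].
Qed.

Lemma sim_refl x (f : {path unitI R from p to x in X}) : sim f f.
Proof. by apply: sim_homotopic; reflexivity. Qed.

Lemma sim_sym x (f g : {path unitI R from p to x in X}) : sim f g -> sim g f.
Proof.
move=> [l Nl fg]; exists (path_reverse l); first exact: subgroupV.
by rewrite fg path_concatA path_concatNp path_concat1p.
Qed.

Lemma sim_trans x (f g k : {path unitI R from p to x in X}) :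
  sim f g -> sim g k -> sim f k.
Proof.
move=> [l Nl fg] [m Nm gk]; exists (path_concat l m); first exact: subgroupM.
by rewrite fg gk path_concatA.
Qed.

Lemma sim_concat x y (f g : {path unitI R from p to x in X})
    (s : {path unitI R from x to y in X}) :
  sim f g -> sim (path_concat f s) (path_concat g s).
Proof.
by move=> [l Nl fg]; exists l; rewrite // fg path_concatA.
Qed.

(** Choose a path [a] from [p] to [x]. The loop that follows [a], stays at [x] and
    returns is null-homotopic, so that all loops near it are in [N] since [N] is
    open; in particular so is the one that follows [a], a small loop [c] at [x]
    and returns. By normality, [a] may then be replaced by any path [f]. *)
Lemma sim_small_loop x : geodesic_space X -> exists2 d, 0 < d &
  forall (c : loop x) (f : {path unitI R from p to x in X}),
    (forall t, mdist x (c t) < d) -> sim (path_concat f c) f.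
Proof.
move=> gX; have [a _] := geodesic_path p x gX.
pose l (c : loop x) : loop p := path_concat a (path_concat c (path_reverse a)).
pose c0 : loop x := cst x.
have Nl0 : subgroup_set N (homotopy_class (l c0)).
  suff -> : homotopy_class (l c0) =
    homotopy_class (cst p : {path unitI R from p to p in X}) by exact: subgroup1.
  by apply/homotopy_classP; rewrite /l /c0 path_concat1p path_concatpN.
have : nbhs (l c0) (@homotopy_class _ _ p @^-1` subgroup_set N).
  by apply: open_nbhs_nbhs; split; [exact: (subgroup_open N)|].
move=> /loop_nbhsP[d d0 dN]; exists d => // c f cd.
have Nlc : subgroup_set N (homotopy_class (l c)).
  apply: dN => t; rewrite /l /path_concat/= /mk_path /concat_fun/= /mk_path.
  case: ifP => _; rewrite ?mdistxx//; rewrite /concat_fun.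
  by case: ifP => _; rewrite ?mdistxx.
pose m : loop p := path_concat f (path_reverse a).
pose m' : loop p := path_concat a (path_reverse f).
exists (path_concat (path_concat m (l c)) m').
  have mV : (homotopy_class m)^-1%g = homotopy_class m'.
    apply: mulg1_eq; rewrite [LHS]pi1_mulE; apply/homotopy_classP.
    by rewrite /m /m' path_concatA path_concatVK path_concatpN.
  have [_ _ _ NJ] := subgroup_normal N; have := NJ _ (homotopy_class m) Nlc.
  rewrite mV [X in subgroup_set N X](_ : _ =
    homotopy_class (path_concat (path_concat m (l c)) m'))//.
  by rewrite -!pi1_mulE.
by rewrite /m /m' /l !path_concatA !path_concatVK.
Qed.

End small_loops.


Section cover_of_subgroup.
Context {R : realType} {X : metricType R} {p : X}.
Context (N : @open_normal_subgroup R X p).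
Implicit Types x y z : X.

Definition simb x : rel {path unitI R from p to x in X} := fun f g => `[< sim N f g >].

Lemma simb_refl x : reflexive (@simb x).
Proof. by move=> f; apply/asboolP/sim_refl. Qed.

Lemma simb_sym x : symmetric (@simb x).
Proof. by move=> f g; apply/idP/idP => /asboolP fg; apply/asboolP/sim_sym. Qed.

Lemma simb_trans x : transitive (@simb x).
Proof.
by move=> g f k /asboolP fg /asboolP gk; apply/asboolP; exact: sim_trans gk.
Qed.

Canonical simb_equiv x :=
  EquivRel (@simb x) (@simb_refl x) (@simb_sym x) (@simb_trans x).

(** The quotient by [sim] is taken separately over each end point, so that the
    projection of the cover is the tag of a dependent pair. *)
Definition fiber x : Type := {eq_quot (simb_equiv x)}.

HB.instance Definition _ x := Quotient.on (fiber x).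
HB.instance Definition _ x := Choice.on (fiber x).

Definition subgroup_cover : Type := {x : X & fiber x}.

HB.instance Definition _ := Choice.on subgroup_cover.

Definition pt x (f : {path unitI R from p to x in X}) : subgroup_cover :=
  existT fiber x (\pi_(fiber x) f).

Definition cover_proj (a : subgroup_cover) : X := tag a.

Definition representative (a : subgroup_cover) :
    {path unitI R from p to cover_proj a in X} :=
  repr (tagged a).

Lemma ptP x (f g : {path unitI R from p to x in X}) : pt f = pt g <-> sim N f g.
Proof.
split=> fg.
  by apply/asboolP/(@eqmodP _ (simb_equiv x)); exact: eq_from_Tagged fg.
by congr existT; apply/eqmodP/asboolP.
Qed.

Lemma representativeK a : pt (representative a) = a.
Proof. by case: a => x a; rewrite /pt /representative/= reprK. Qed.

Lemma pt_ind (P : subgroup_cover -> Prop) :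
  (forall x (f : {path unitI R from p to x in X}), P (pt f)) -> forall a, P a.
Proof. by move=> Pf a; rewrite -(representativeK a); exact: Pf. Qed.

Lemma representative_sim x (f : {path unitI R from p to x in X}) :
  sim N (representative (pt f)) f.
Proof. exact/ptP/representativeK. Qed.

Lemma pt_eq x y (f : {path unitI R from p to x in X})
  (g : {path unitI R from p to y in X}) : x = y -> f =1 g -> pt f = pt g.
Proof. by move=> xy; move: g; rewrite -xy => g /path_eqP ->. Qed.

(** Defining the open sets, instead of a basis of sheets, makes the axioms of a
    topology immediate; that the sheets are open is shown over
    balls in which loops are absorbed by [sim]. *)
Definition subgroup_cover_open (A : set subgroup_cover) : Prop :=
  forall x (f : {path unitI R from p to x in X}), A (pt f) ->
    exists2 r, 0 < r & forall y (s : {path unitI R from x to y in X}),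
      (forall t, mdist x (s t) < r) -> A (pt (path_concat f s)).

Lemma subgroup_cover_openT : subgroup_cover_open setT.
Proof. by move=> x f _; exists 1. Qed.

Lemma subgroup_cover_openI (A B : set subgroup_cover) :
  subgroup_cover_open A -> subgroup_cover_open B -> subgroup_cover_open (A `&` B).
Proof.
move=> oA oB x f [/oA[r r0 rA] /oB[r' r'0 r'B]].
exists (Num.min r r'); first by rewrite lt_min r0.
move=> y s sr; split.
  by apply: rA => t; have := sr t; rewrite lt_min => /andP[].
by apply: r'B => t; have := sr t; rewrite lt_min => /andP[].
Qed.

Lemma subgroup_cover_open_bigcup (I : Type) (F : I -> set subgroup_cover) :
  (forall i, subgroup_cover_open (F i)) -> subgroup_cover_open (\bigcup_i F i).
Proof.
move=> oF x f [i _ /oF[r r0 rF]]; exists r => // y s sr.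
by exists i => //; exact: rF.
Qed.

HB.instance Definition _ :=
  isOpenTopological.Build subgroup_cover subgroup_cover_openT
    subgroup_cover_openI subgroup_cover_open_bigcup.

Lemma subgroup_cover_openE (A : set subgroup_cover) :
  open A = subgroup_cover_open A.
Proof. by []. Qed.

Lemma cover_proj_continuous : continuous cover_proj.
Proof.
apply/continuousP => O oO; rewrite subgroup_cover_openE => x f /= Ox.
have /nbhs_metricP[r r0 rO] : nbhs x O by exact: open_nbhs_nbhs.
by exists r => // y s sr; apply: rO; have := sr one; rewrite path_one.
Qed.

(** * Lifting of paths *)

Definition path_lift x y (f : {path unitI R from p to x in X})
    (g : {path unitI R from x to y in X}) (t : unitI R) : subgroup_cover :=
  pt (path_concat f (initial_path g t)).

(** The lift of [g] at a time [s] near [t] is the continuation of its lift at [t]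
    by the part of [g] from [t] to [s], which is short. *)
Lemma path_lift_continuous x y (f : {path unitI R from p to x in X})
  (g : {path unitI R from x to y in X}) : continuous (path_lift f g).
Proof.
move=> t A; rewrite nbhsE => -[B [oB Bt] BA].
have [r r0 rB] := oB _ _ Bt.
have : nbhs (g t) (ball (g t) r) by exact: nbhsx_ballx.
move=> /(@cts_fun _ _ g t)/unit_nbhsP[d d0 dr].
apply/unit_nbhsP; exists d => // s st; apply: BA.
suff -> : path_lift f g s = pt (path_concat (path_concat f (initial_path g t))
    (restr_path g t s)).
  apply: rB => u; rewrite -in_ball; apply: dr.
  have /andP[u0 u1] := unit_valP u; have /andP[s0 s1] := unit_valP s.
  have /andP[t0 t1] := unit_valP t.
  rewrite clampE; last first.
    apply/andP; split; last by nra.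
    by nra.
  rewrite addrK normrM [X in _ * X]ger0_norm//.
  by rewrite (le_lt_trans _ st)// ler_piMr.
by apply/ptP/sim_homotopic; rewrite (initial_restr_path g t s) path_concatA.
Qed.

Lemma path_lift0 x y (f : {path unitI R from p to x in X})
  (g : {path unitI R from x to y in X}) : path_lift f g zero = pt f.
Proof.
have -> : path_lift f g zero = pt (path_concat f (cst x)).
  apply: pt_eq; first by rewrite path_zero.
  move=> u; rewrite [LHS](_ : _ = concat_fun f (initial_fun g zero) u)//.
  rewrite [RHS](_ : _ = concat_fun f (cst x) u)// /concat_fun; case: ifP => // _.
  by rewrite /initial_fun unit_val0 mul0r addr0 path_zero.
by apply/ptP/sim_homotopic; rewrite path_concatp1.
Qed.

Lemma path_lift1 x y (f : {path unitI R from p to x in X})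
  (g : {path unitI R from x to y in X}) : path_lift f g one = pt (path_concat f g).
Proof.
apply: pt_eq; first by rewrite path_one.
move=> u; rewrite [LHS](_ : _ = concat_fun f (initial_fun g one) u)//.
rewrite [RHS](_ : _ = concat_fun f g u)// /concat_fun; case: ifP => // _.
by rewrite /initial_fun unit_val1 mul1r addr0 clampK.
Qed.

(** Every path is joined to the constant path by its initial parts. *)
Lemma subgroup_cover_connected : connected [set: subgroup_cover].
Proof.
have -> : [set: subgroup_cover] = \bigcup_(a in [set: subgroup_cover])
    range (path_lift (cst p : {path unitI R from p to p in X}) (representative a)).
  apply/seteqP; split=> // a _; exists a => //; exists one => //.
  rewrite path_lift1 -[RHS]representativeK.
  by apply/ptP/sim_homotopic; rewrite path_concat1p.
apply: bigcup_connected.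
  exists (pt (cst p : {path unitI R from p to p in X})) => a _.
  by exists zero => //; rewrite path_lift0.
move=> a _; apply: connected_continuous_connected; first exact: unitI_connected.
by apply: continuous_subspaceT; exact: path_lift_continuous.
Qed.

(** * Local sections *)

(** If loops at [x] inside a ball are absorbed, so are the differences of paths with
    the same ends inside the ball: join [x] to the ends by the path [k] inside the
    ball. *)
Lemma sim_in_small_ball x (d : R) : geodesic_space X ->
  (forall (c : loop x) (f : {path unitI R from p to x in X}),
    (forall t, mdist x (c t) < d) -> sim N (path_concat f c) f) ->
  forall y z (f : {path unitI R from p to y in X})
    (s s' : {path unitI R from y to z in X}),
    (forall t, mdist x (s t) < d) -> (forall t, mdist x (s' t) < d) ->
    sim N (path_concat f s) (path_concat f s').
Proof.
move=> gX dN y z f s s' sd s'd; have [k kP] := geodesic_path x y gX.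
have yd : mdist x y < d by have := sd zero; rewrite path_zero.
have kd t : mdist x (k t) < d by exact: le_lt_trans (kP t) yd.
pose c : loop x := path_concat (path_concat (path_concat k s) (path_reverse s'))
  (path_reverse k).
have cd t : mdist x (c t) < d.
  apply: (concat_fun_in (A := [set y | mdist x y < d])) => [{}t|{}t]; last exact: kd.
  apply: (concat_fun_in (A := [set y | mdist x y < d])) => [{}t|{}t]; last exact: s'd.
  exact: (concat_fun_in (A := [set y | mdist x y < d])).
have := dN c (path_concat f (path_reverse k)) cd.
move=> /(@sim_concat _ _ _ N _ _ _ _ k)/(@sim_concat _ _ _ N _ _ _ _ s') H.
apply: sim_trans (sim_trans _ H) _; apply: sim_homotopic.
  by rewrite /c !path_concatA !path_concatVK.
by rewrite path_concatVK.
Qed.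

(** Take a ball at [x] in which all small loops are absorbed. Its sheets consist
    of the continuations of a path to a point [y] of the ball by paths inside the
    ball; the section [S] uses the paths from [y] to [z] through the centre
    [x]. *)
Lemma cover_projP : geodesic_space X -> is_cover cover_proj.
Proof.
move=> gX; split.
- exact: subgroup_cover_connected.
- exact: cover_proj_continuous.
- apply/seteqP; split=> // x _; have [f _] := geodesic_path p x gX.
  by exists (pt f).
move=> x; have [d d0 /(sim_in_small_ball gX) dN] := sim_small_loop N x gX.
exists (ball x d); split; first exact: metric_ball_open.
  by rewrite in_ball mdistxx.
pose k y := sval (cid (geodesic_path x y gX)).
have kP y : forall t, mdist x (k y t) <= mdist x y by rewrite /k; case: cid.
have kd y : mdist x y < d -> forall t, mdist x (k y t) < d.
  by move=> yd t; exact: le_lt_trans (kP y t) yd.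
have near_kd y z (s : {path unitI R from y to z in X}) : mdist x y < d ->
    (forall t, mdist y (s t) < d - mdist x y) ->
    forall t, mdist x (path_concat (k y) s t) < d.
  move=> yd sd; apply: (concat_fun_in (A := [set y | mdist x y < d])) => t.
    exact: kd.
  by have := sd t; have := metric_triangle x y (s t); rewrite /=; lra.
pose S (a : subgroup_cover) y : subgroup_cover :=
  pt (path_concat
    (path_concat (representative a) (path_reverse (k (cover_proj a)))) (k y)).
have SE y (f : {path unitI R from p to y in X}) z :
    S (pt f) z = pt (path_concat (path_concat f (path_reverse (k y))) (k z)).
  by apply/ptP/sim_concat/sim_concat/representative_sim.
apply: (sections_evenly_covered (S := S)) => //.
- exact: metric_ball_open.
- exact: cover_proj_continuous.
elim/pt_ind => y f; rewrite /= in_ball => yd; split.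
- rewrite subgroup_cover_openE => z g [z' z'd gz'].
  have /(congr1 cover_proj)/= zz' := gz'; subst z.
  move: gz'; rewrite SE => /ptP fg; rewrite in_ball in z'd.
  exists (d - mdist x z'); first by rewrite subr_gt0.
  move=> w s sd; have sw := near_kd _ _ s z'd sd.
  have wd : mdist x w < d by have := sw one; rewrite path_one.
  exists w; first by rewrite in_ball.
  rewrite SE; apply/ptP; apply: sim_trans (sim_concat s fg).
  apply: sim_trans (dN _ _ _ (k w) (path_concat (k z') s) (kd _ wd) sw) _.
  by apply: sim_homotopic; rewrite path_concatA.
- by rewrite SE; apply/ptP/sim_homotopic; rewrite path_concatVK.
- move=> u; rewrite in_ball => ud A; rewrite nbhsE => -[B [oB Bu] BA].
  rewrite SE in Bu; have [r r0 rB] := oB _ _ Bu.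
  apply/nbhs_metricP; exists (Num.min r (d - mdist x u)).
    by rewrite lt_min r0 subr_gt0.
  move=> v; rewrite lt_min => /andP[vr vd]; apply: BA; rewrite SE.
  have [s sP] := geodesic_path u v gX.
  have sw : forall t, mdist x (path_concat (k u) s t) < d.
    by apply: near_kd => // t; exact: le_lt_trans (sP t) vd.
  have xv : mdist x v < d by have := sw one; rewrite path_one.
  suff -> : pt (path_concat (path_concat f (path_reverse (k y))) (k v)) =
      pt (path_concat (path_concat (path_concat f (path_reverse (k y))) (k u)) s).
    by apply: rB => t; exact: le_lt_trans (sP t) vr.
  apply/ptP; apply: sim_trans (dN _ _ _ (k v) (path_concat (k u) s) (kd _ xv) sw) _.
  by apply: sim_homotopic; rewrite path_concatA.
- move=> u _; split=> // v _; rewrite !SE.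
  by apply/ptP/sim_homotopic; rewrite path_concatK.
Qed.

(** The lift of [g] that starts at [pt f] ends at the class of [f] followed by
    [g]. *)
Lemma loop_lift_closed (f g : loop p) :
  pt (path_concat f g) = pt f -> subgroup_set N (homotopy_class g).
Proof.
move=> /ptP[l Nl fgl]; have [_ _ _ NJ] := subgroup_normal N.
have fg : (homotopy_class f * homotopy_class g = homotopy_class l * homotopy_class f)%g.
  rewrite [LHS]pi1_mulE [RHS]pi1_mulE; exact/homotopy_classP.
have -> : homotopy_class g = ((homotopy_class f)^-1 * homotopy_class l *
    (homotopy_class f)^-1^-1)%g.
  by rewrite invgK -mulgA -fg mulKg.
exact: NJ.
Qed.

End cover_of_subgroup.


(** * Universal covers *)

Section universal_cover.
Context {R : realType} {X : metricType R} {p : X}.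
Context (cX : compact [set: X]) (gX : geodesic_space X).

Section end_map.
Context (N : @open_normal_subgroup R X p).
Context {Z : topologicalType} (g : Z -> X) (e : R) (T : Z -> X -> Z) (z0 : Z).
Context (e0 : 0 < e) (TP : transport g e T) (gz0 : g z0 = p).
Context (NK : subgroup_set N `<=` @K_eps _ _ e p).

(** The end of the lift to [Z] of a path from [p]. It is computed by transport along
    a strong chain instead of a lift, so that paths in [Z] need not be
    constructed. *)
Definition end_map (a : subgroup_cover N) : Z :=
  foldl T z0 (sval (cid (strong_chain_ex (@cts_fun _ _ (representative a)) e0))).

(** A loop in [N] has a null-homotopic strong chain, along which transport is the
    identity; so equivalent paths have the same end. *)
Lemma end_mapE x (f : {path unitI R from p to x in X}) c :
  strong_chain e f c -> end_map (pt N f) = foldl T z0 c.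
Proof.
move=> fc; rewrite /end_map; case: cid => c' /= c'P.
have [l /NK Kl fl] := representative_sim N f.
have [d ld hd] := h_eps_ex e0 l.
have d0 : open_homotopic e p (points d) [::].
  by apply/(open_homotopicP d (nil_chain e p)); rewrite -hd Kl.
have l1 : l one = f zero by rewrite path_one path_zero.
have lfc := strong_chain_concat l1 ld fc.
apply: (transport_homotopic TP); rewrite gz0.
apply: rst_trans (strong_chain_homotopic e0 fl c'P lfc) _.
apply: (open_homotopic_catr _ d0); rewrite points_last.
by have := strong_chain_path fc; rewrite path_zero.
Qed.

(** Extending a path by a path inside a small ball extends its strong chain by one
    point, which moves the end inside one sheet. *)
Lemma end_map_continuous : continuous end_map.
Proof.
apply/continuousP => O oO; rewrite subgroup_cover_openE => x f /=.
have [c fc] := strong_chain_ex (@cts_fun _ _ f) e0.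
rewrite (end_mapE fc) => Oc.
have gc : g (foldl T z0 c) = x.
  have f0 : f zero = p by rewrite path_zero.
  have f1 : f one = x by rewrite path_one.
  rewrite (transport_path TP) gz0 -f0 ?(strong_chain_last fc)//.
  exact: strong_chain_path.
have [Tx Tc _] := TP (foldl T z0 c); rewrite gc in Tx Tc.
have : nbhs x (T (foldl T z0 c) @^-1` O).
  have [_ cT] : g (T (foldl T z0 c) x) = x /\ {for x, continuous (T (foldl T z0 c))}.
    by apply: Tc; rewrite mdistxx.
  by apply: cT; rewrite Tx; exact: open_nbhs_nbhs.
move=> /nbhs_metricP[r r0 rO].
exists (Num.min r (e / 2)); first by rewrite lt_min r0 divr_gt0.
move=> y s sr.
have s0 : s zero = x by rewrite path_zero.
have s1 : s one = y by rewrite path_one.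
have se t : mdist x (s t) < e / 2 by have := sr t; rewrite lt_min => /andP[].
have ss : strong_chain e s [:: s one].
  apply: strong_chain1 => t; first by rewrite s0 (lt_trans (se t))//; move: (e0); lra.
  rewrite (splitr e); apply: (mdist_tri (y := x)) => //.
  by rewrite metric_sym.
have f1 : f one = s zero by rewrite path_one path_zero.
have fsc : strong_chain e (path_concat f s) (c ++ [:: s one]).
  exact: strong_chain_concat f1 fc ss.
rewrite (end_mapE fsc) foldl_cat /= s1.
by apply: rO; have := sr one; rewrite s1 lt_min => /andP[].
Qed.

Lemma end_map_proj : g \o end_map = @cover_proj _ _ _ N.
Proof.
apply/funext; elim/(@pt_ind _ _ _ N) => x f /=.
have [c fc] := strong_chain_ex (@cts_fun _ _ f) e0.
have f0 : f zero = p by rewrite path_zero.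
have f1 : f one = x by rewrite path_one.
rewrite (end_mapE fc) (transport_path TP) gz0 -f0 ?(strong_chain_last fc)//.
exact: strong_chain_path.
Qed.

End end_map.

Lemma universal_cover_ex : open (@pi_cl _ _ p) -> has_universal_cover X.
Proof.
move=> oN; pose N := OpenNormalSubgroup pi_cl_normal oN.
exists (subgroup_cover N), (@cover_proj _ _ _ N); split; first exact: cover_projP.
move=> Z g cg; have [e e0 [T TP]] := cover_transport cX gX cg.
have [_ _ rg _] := cg.
have [z0 _ gz0] : range g p by rewrite rg.
have NK : subgroup_set N `<=` @K_eps _ _ e p by move=> a /(_ _ e0).
exists (end_map (N := N) T z0 e0); split; last exact: end_map_proj.
apply: (cover_factor gX (cover_projP N gX) cg).
  exact: end_map_continuous.
exact: end_map_proj.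
Qed.

(** Let [e] be the scale of the universal cover [Y] and let [c] be a loop in
    [K_eps] for [e]; its transport in [Y] is trivial. The map [h] from [Y] to the
    cover defined by [K_eps] for any [d] carries this transport to the lift of [c],
    which is therefore closed, so that [c] is in [K_eps] for [d]. *)
Lemma universal_cover_K_eps : has_universal_cover X ->
  exists2 e, 0 < e & @K_eps _ _ e p `<=` @pi_cl _ _ p.
Proof.
move=> [Y [f [cf univ]]]; have [e e0 [T TP]] := cover_transport cX gX cf.
exists e => // a Ka d /= d0.
have oK : open (@K_eps _ _ d p) by exact: (h_eps_open d0 [set 1%g]).
pose N := OpenNormalSubgroup (K_eps_normal d0) oK.
have cN : is_cover (@cover_proj _ _ _ N) := cover_projP N gX.
have [h [ch hf]] := univ _ _ cN.
have [_ _ rf _] := cf; have [_ hcont _ _] := ch.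
have [y0 _ fy0] : range f p by rewrite rf.
move: a Ka; elim/(@pi1_ind R X p) => c Kc.
have [cc ccP hcc] := h_eps_ex e0 c.
have T0 : foldl T y0 (points cc) = y0.
  apply: (transport_homotopic (c' := [::]) TP); rewrite fy0.
  by apply/(open_homotopicP cc (nil_chain e p)); rewrite -hcc Kc.
have hE y : cover_proj (h y) = f y by rewrite -hf.
(* Both [h] applied to the transport along [s] and the lift of [s] are lifts of [s]
   to the cover defined by [N]. *)
have step y x z (b : {path unitI R from p to x in X})
    (s : {path unitI R from x to z in X}) : h y = pt N b ->
    (forall t, mdist x (s t) < e) -> h (T y z) = pt N (path_concat b s).
  move=> hy sx; have fy : f y = x by rewrite -hE hy.
  have [Ty Tc _] := TP y; rewrite fy in Ty Tc.
  have s0 : s zero = x by rewrite path_zero.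
  have s1 : s one = z by rewrite path_one.
  rewrite -path_lift1 -{1}s1.
  apply: (lift_unique (A := setT) (u := fun t => h (T y (s t)))
    (v := path_lift N b s) (a := zero) cN) => //.
  - exact: unitI_connected.
  - move=> t _; apply: (continuous_comp (f := fun t => T y (s t))); last exact: hcont.
    apply: (continuous_comp (f := s)); first exact: cts_fun.
    by have [] := Tc (s t) (sx t).
  - by move=> t _; exact: path_lift_continuous.
  - by move=> t _; rewrite hE; have [-> _] := Tc (s t) (sx t).
  - by rewrite s0 Ty hy path_lift0.
have [b hb] : exists b : loop p, h y0 = pt N b.
  have : cover_proj (h y0) = p by rewrite hE.
  elim/(@pt_ind _ _ _ N): (h y0) => x b /= xp; subst x; by exists b.
have /strong_chainP[ts [pts lts] ccE] := ccP.
have walk s us y : path (tame e c) s us -> h y = path_lift N b c s ->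
    h (foldl T y (map c us)) = path_lift N b c (last s us).
  elim: us s y => //= t us IH s y /andP[/andP[st /asboolP cst] pus] hy.
  apply: IH => //; rewrite (step y _ _ _ (restr_path c s t) hy).
    apply/ptP/sim_homotopic.
    by rewrite (initial_restr_path c s t) path_concatA.
  move=> u; have /andP[u0 u1] := unit_valP u; have /andP[s0 s1] := unit_valP s.
  have /andP[t0 t1] := unit_valP t.
  by apply: (cst _ _).1; rewrite clampE; nra.
have := walk zero ts y0 pts; rewrite path_lift0 => /(_ hb).
rewrite lts path_lift1 -ccE T0 hb => bc.
by have := loop_lift_closed (esym bc).
Qed.

End universal_cover.

Theorem theorem1p2 (R : realType) (X : metricType R) (p : X) :
  compact [set: X] -> geodesic_space X ->
  [/\ quasitopological_group (T := pi1_bar p) (cosets_one _) (@cosets_inv _ _)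
        (@cosets_mul _ _),
      accessible_space (pi1_bar p) &
      has_universal_cover X <-> discrete_space (pi1_bar p)].
Proof.
move=> cX gX; split; [exact: pi1_bar_quasitopological|exact: pi1_bar_accessible|].
split=> [/(universal_cover_K_eps (p := p) cX gX)[e e0 Ke]|/discrete_pi_cl_open].
  exact: K_eps_discrete e0 Ke.
exact: universal_cover_ex.
Qed.
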